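(* Let $G$ be a Polish group with a near-action on a standard Borel probability space $(X,\mathcal{X},\mu)$. The near-action admits a spatial model if and only if there exists a sequence of $G$-continuous functions in $L^\infty(\mu)$ that generates the $\sigma$-algebra $\mathcal{X}$ modulo $\mu$-null sets (equivalently: that separates points, modulo a $\mu$-null set).
   Context: Near-action: for a Polish group $G$ and a standard Borel space with a probability measure $(X,\mathcal{X},\mu)$, a near-action is a Borel map $G\times X\to X$, $(g,x)\mapsto gx$, such that (i) $ex=x$ for almost every $x$; (ii) for each pair $g,h\in G$, $g(hx)=(gh)x$ for almost every $x$ (the null set may depend on $g,h$); (iii) each $g\in G$ preserves $\mu$. $G$-continuous function: $f\in L^\infty(\mu)$ (real-valued functions) is $G$-continuous if $f\circ g_n$ converges to $f$ in the $L^\infty(\mu)$ norm whenever $g_n\to e$ in $G$, where $(f\circ g)(x)=f(gx)$. Spatial model: a spatial $G$-action is a Borel map $G\times Y\to Y$ on a standard Borel probability space $(Y,\mathcal{Y},\nu)$ with $ey=y$ and $g(hy)=(gh)y$ for all $g,h\in G$ and all $y\in Y$, such that each $g$ preserves $\nu$. A spatial model of a near-action on $(X,\mathcal{X},\mu)$ is a spatial action on some $(Y,\mathcal{Y},\nu)$ that, viewed as a near-action, is isomorphic to the given one: there is an invertible mod 0 measure preserving map $\varphi:X\to Y$ such that for each $g\in G$, $\varphi(gx)=g\varphi(x)$ for almost every $x$ (the null set may depend on $g$). Equivalently, the induced actions on the measure algebras are isomorphic. A sequence $(f_n)$ in $L^\infty(\mu)$ separates points mod 0 if, for some (any) choice of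 representatives, there is a set of full measure on which $x\ne x'$ implies $f_n(x)\neq f_n(x')$ for some $n$. *)

(* Defs.v *)
From HB Require Import structures.
From mathcomp Require Import all_boot all_order all_algebra.
From mathcomp Require Import all_classical all_reals all_analysis.

Set Implicit Arguments.
Unset Strict Implicit.
Unset Printing Implicit Defensive.

Import Order.TTheory GRing.Theory Num.Theory.
Import numFieldNormedType.Exports.

Local Open Scope classical_set_scope.
Local Open Scope ring_scope.

HB.mixin Record isTopologicalGroup G of Group G & Topological G := {
  mulg_continuous : continuous (fun gh : G * G => (gh.1 * gh.2)%g) ;
  invg_continuous : continuous (fun g : G => (g^-1)%g)
}.

#[short(type="topologicalGroupType")]
HB.structure Definition TopologicalGroup :=
  {G of Group G & Topological G & isTopologicalGroup G}.

Definition separable (T : topologicalType) : Prop :=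
  exists2 D : set T, countable D & dense D.

Definition completely_metrizable (R : realType) (T : topologicalType) : Prop :=
  exists (M : metricType R) (f : T -> M) (g : M -> T),
    [/\ cancel f g, cancel g f, continuous f, continuous g &
        forall F : set_system M, ProperFilter F -> cauchy F ->
          exists x : M, F --> x].

Definition polish (R : realType) (T : topologicalType) : Prop :=
  separable T /\ completely_metrizable R T.

(* A Polish topology on [X] is given as the topology transported along a
   bijection onto a Polish space [T]. *)
Definition standard_borel (R : realType) d (X : measurableType d) : Prop :=
  exists (T : topologicalType) (f : X -> T),
    [/\ polish R T, bijective f &
        @measurable d X = preimage_set_system [set: X] f <<s @open T >>].

(* [measurableType] requires a default point: the neutral element is used. *)
Definition pointed_group (G : topologicalGroupType) : Type := G.
HB.instance Definition _ (G : topologicalGroupType) :=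
  Choice.on (pointed_group G).
HB.instance Definition _ (G : topologicalGroupType) :=
  isPointed.Build (pointed_group G) (1%g : G).

Definition borel_group (G : topologicalGroupType) :=
  @g_sigma_algebraType (pointed_group G) (@open G).
HB.instance Definition _ (G : topologicalGroupType) :=
  Measurable.copy (borel_group G)
    (@g_sigma_algebraType (pointed_group G) (@open G)).

Definition borel_action (G : topologicalGroupType) d (X : measurableType d)
    (a : G -> X -> X) : Prop :=
  measurable_fun [set: borel_group G * X] (fun gx => a gx.1 gx.2).

Definition measure_preserving (R : realType) d d' (X : measurableType d)
    (Y : measurableType d') (mu : probability X R) (nu : probability Y R)
    (f : X -> Y) : Prop :=
  measurable_fun [set: X] f /\
  forall A : set Y, measurable A -> pushforward mu f A = nu A.

Definition near_action (R : realType) (G : topologicalGroupType) d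
    (X : measurableType d) (mu : probability X R) (a : G -> X -> X) : Prop :=
  [/\ borel_action a,
      \forall x \ae mu, a 1%g x = x,
      forall g h : G, \forall x \ae mu, a g (a h x) = a (g * h)%g x &
      forall g : G, measure_preserving mu mu (a g)].

Definition spatial_action (R : realType) (G : topologicalGroupType) d
    (Y : measurableType d) (nu : probability Y R) (b : G -> Y -> Y) : Prop :=
  [/\ borel_action b,
      forall y, b 1%g y = y,
      forall (g h : G) y, b g (b h y) = b (g * h)%g y &
      forall g : G, measure_preserving nu nu (b g)].

Definition invertible_mod0 (R : realType) d d' (X : measurableType d)
    (Y : measurableType d') (mu : probability X R) (nu : probability Y R)
    (phi : X -> Y) : Prop :=
  exists psi : Y -> X, [/\ measure_preserving nu mu psi,
    \forall x \ae mu, psi (phi x) = x & \forall y \ae nu, phi (psi y) = y].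

Definition near_action_isomorphic (R : realType) (G : topologicalGroupType)
    d d' (X : measurableType d) (Y : measurableType d')
    (mu : probability X R) (nu : probability Y R)
    (a : G -> X -> X) (b : G -> Y -> Y) : Prop :=
  exists phi : X -> Y,
    [/\ measure_preserving mu nu phi, invertible_mod0 mu nu phi &
        forall g : G, \forall x \ae mu, phi (a g x) = b g (phi x)].

Definition has_spatial_model (R : realType) (G : topologicalGroupType) d
    (X : measurableType d) (mu : probability X R) (a : G -> X -> X) : Prop :=
  exists (d' : measure_display) (Y : measurableType d')
      (nu : probability Y R) (b : G -> Y -> Y),
    [/\ standard_borel R Y, spatial_action nu b &
        near_action_isomorphic mu nu a b].

(* Elements of L^oo(mu) are given by representatives. *)
Definition G_continuous (R : realType) (G : topologicalGroupType) d
    (X : measurableType d) (mu : probability X R) (a : G -> X -> X)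
    (f : X -> R) : Prop :=
  f \in Lfun mu +oo%E /\
  forall u : nat -> G, u @ \oo --> (1%g : G) ->
    'N[mu]_+oo [EFin \o ((f \o a (u n)) \- f)%R]%E @[n --> \oo] --> 0%E.

Definition generates_mod0 (R : realType) d (X : measurableType d)
    (mu : probability X R) (f : nat -> X -> R) : Prop :=
  forall A : set X, measurable A ->
    exists2 B : set X,
      <<s \bigcup_n preimage_set_system [set: X] (f n) measurable >> B &
      mu (A `+` B) = 0%E.

Definition separates_points_mod0 (R : realType) d (X : measurableType d)
    (mu : probability X R) (f : nat -> X -> R) : Prop :=
  exists E : set X, [/\ measurable E, mu E = 1%E &
    forall x x', E x -> E x' -> x <> x' -> exists n, f n x <> f n x'].

(* Main.v *)
Require Import Defs.
From HB Require Import structures.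
From mathcomp Require Import all_boot all_order all_algebra.
From mathcomp Require Import all_classical all_reals all_analysis.
From mathcomp Require Import measurable_realfun ess_sup_inf lra zify.

Set Implicit Arguments.
Unset Strict Implicit.
Unset Printing Implicit Defensive.

Import Order.TTheory GRing.Theory Num.Theory.
Import numFieldNormedType.Exports.

Local Open Scope classical_set_scope.
Local Open Scope ring_scope.

(* If (f_n) is a generating sequence of G-continuous functions, then for almost
   every x the orbit functions g |-> f_n (g x) agree, on a countable dense
   subset of G, with continuous functions whose moduli of continuity depend
   only on n; the functions with these moduli form a Polish space on which G
   acts by right translation, and the image of mu there is a spatial model.
   Conversely, in a spatial model one takes the Vaught transforms
   { y | g y is in S for nonmeagerly many g in B } for B in a chain of open
   sets indexed by dyadic rationals, in which right multiplication by V_n moves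
   up by at most 2^-n: the height at which y enters the chain is a Borel
   function of y, uniformly continuous along the action, and by the Baire
   category theorem such functions separate points. Separating and generating
   sequences are the same modulo null sets because, by inner regularity, a
   Borel set can be exhausted by compact sets on which the functions are
   continuous. *)

(** * Polish metrics *)

(** For a near-action the value f (g x) is meaningful only up to a null set depending on g, and
    uncountably many such null sets cannot be discarded together. Convergence in the L^oo norm is
    what helps: since each g preserves mu, a bound on f (h x) - f x for h near the identity can be
    read at g x, and becomes a bound on f (g' x) - f (g x) whenever g' * g^-1 is near the identity,
    with one constant for almost all x. Restricted to a dense sequence these are countably many
    conditions. They involve g' * g^-1 only, which does not change when g and g' are multiplied on
    the right by the same element. In the other direction G need not be locally compact, so there
    may be no Haar measure for averaging an indicator along orbits; Baire category replaces the
    average. The chain of open sets is built as in the Birkhoff-Kakutani metrization theorem, but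
    starts from an arbitrary open set of G. *)

Lemma invn_lt (R : realType) (e : R) : 0 < e -> exists n : nat, n.+1%:R^-1 < e.
Proof.
move=> e0; have [n ne] := ltr_add_invr (y := 0) (x := e) e0.
by exists n; rewrite add0r in ne.
Qed.

(* Completeness is only asked of sequences with an explicit rate of
   convergence. *)
Record polish_metric (R : realType) (T : Type) (rho : T -> T -> R)
    (q : nat -> T) : Prop := PolishMetric {
  pm_refl : forall x, rho x x = 0 ;
  pm_eq0 : forall x y, rho x y = 0 -> x = y ;
  pm_sym : forall x y, rho x y = rho y x ;
  pm_tri : forall y x z, rho x z <= rho x y + rho y z ;
  pm_dense : forall x e, 0 < e -> exists i, rho x (q i) < e ;
  pm_complete : forall u : nat -> T,
    (forall m n, rho (u m) (u n) <= m.+1%:R^-1 + n.+1%:R^-1) ->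
    exists l, forall n, rho (u n) l <= n.+1%:R^-1
}.

Definition metric_open (R : realType) (T : Type) (rho : T -> T -> R) :
    set_system T :=
  [set O | forall x, O x -> exists2 e, 0 < e & forall y, rho x y < e -> O y].

(** The metric is pulled back along the given homeomorphism. The point [t0] makes the countable
    dense set nonempty, so that a total sequence [q] can enumerate it. *)
Lemma polish_polish_metric (R : realType) (T : topologicalType) (t0 : T) :
  polish R T -> exists (rho : T -> T -> R) (q : nat -> T),
    polish_metric rho q /\ @open T = metric_open rho.
Proof.
move=> [[D cD dD] [M [f [g [fg gf cf cg Mc]]]]].
have D0 : D !=set0 by have [x [_ Dx]] := dD setT (ex_intro _ t0 I) openT; exists x.
have [q qD] : exists q : nat -> T, D `<=` range q.
  have /pfcard_geP[D00|[q]] := cD; first by case: D0 => x; rewrite D00.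
  by exists q => x Dx; have [n _ <-] := 'surj_q Dx; exists n.
have openP (O : set T) : open O <-> metric_open (fun x y => mdist (f x) (f y)) O.
  split.
    move=> oO x Ox; have : open (g @^-1` O) by exact: (open_comp (in1W cg)).
    rewrite openE => /(_ (f x)); rewrite /interior /= => H.
    have {H} : nbhs (f x) (g @^-1` O) by apply: H; rewrite /= fg.
    move=> /metricType_numDomainType.nbhs_mdistP[e /= e0 eO].
    by exists e => // y xy; rewrite -(fg y); exact: eO.
  move=> rO; have -> : O = f @^-1` (g @^-1` O).
    by apply/seteqP; split=> x; rewrite /preimage /= fg.
  apply: (open_comp (in1W cf)); rewrite openE => y /= /rO[e e0 eO].
  apply/metricType_numDomainType.nbhs_mdistP; exists e => //= z yz.
  by apply: eO; rewrite !gf.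
exists (fun x y => mdist (f x) (f y)), q; split; last first.
  by apply/seteqP; split=> O /openP.
split.
- by move=> x; exact: mdistxx.
- by move=> x y /mdist_positivity /(can_inj fg).
- by move=> x y; exact: metric_sym.
- by move=> y x z; exact: metric_triangle.
- move=> x e e0.
  have [||y [/= Oy /qD[i _ iy]]] := dD [set y | mdist (f x) (f y) < e].
  + by exists x; rewrite /= mdistxx.
  + apply/openP => y /= xy; exists (e - mdist (f x) (f y)).
      by rewrite subr_gt0.
    move=> z yz; apply: le_lt_trans (metric_triangle _ (f y) _) _.
    by rewrite -ltrBrDl.
  + by exists i; rewrite iy.
- move=> u uc.
  have uC : cauchy (f \o u @ \oo).
    apply: cauchy_exP => e e0.
    have [n ne] : exists n : nat, n.+1%:R^-1 < e / 2 by apply: invn_lt; rewrite divr_gt0.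
    exists (f (u n)); exists n => //= j nj.
    rewrite ballEmdist/=; apply: le_lt_trans (uc n j) _.
    rewrite [e]splitr; apply: ltrD; apply: le_lt_trans ne;
      by rewrite lef_pV2 ?posrE// ler_nat.
  have [l ul] := Mc _ _ uC.
  exists (g l) => n; rewrite gf; apply/ler_addgt0Pl => e e0.
  have e20 : 0 < e / 2 by rewrite divr_gt0.
  have [m me] := invn_lt e20.
  have [k _ kl] := metricType_numDomainType.cvgr_dist_lt ul e20.
  have := kl (maxn k m) (leq_maxl _ _) => /= kml.
  apply: le_trans (metric_triangle _ (f (u (maxn k m))) _) _.
  rewrite metric_sym in kml.
  apply: le_trans (lerD (uc _ _) (ltW kml)) _.
  rewrite -addrA addrC lerD2r [leRHS]splitr lerD2r.
  apply: ltW; apply: le_lt_trans me; by rewrite lef_pV2 ?posrE// ler_nat ltnS leq_maxr.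
Qed.

Lemma preimage_sigma_algebra (aT rT : Type) (f : aT -> rT)
    (G : set_system rT) :
  preimage_set_system setT f <<s G >> = <<s preimage_set_system setT f G >>.
Proof.
apply/seteqP; split.
  have : <<s G >> `<=` image_set_system setT f <<s preimage_set_system setT f G >>.
    apply: smallest_sub.
      exact/sigma_algebra_image/smallest_sigma_algebra.
    by move=> A GA; apply: sub_sigma_algebra; exists A.
  by move=> GS _ [A GA <-]; exact: GS.
apply: smallest_sub.
  exact/sigma_algebra_preimage/smallest_sigma_algebra.
by move=> _ [A GA <-]; exists A => //; exact: sub_sigma_algebra.
Qed.

Lemma standard_borel_metric (R : realType) d (X : measurableType d) :
  standard_borel R X -> exists (rho : X -> X -> R) (q : nat -> X),
    polish_metric rho q /\ @measurable d X = <<s metric_open rho >>.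
Proof.
move=> [T [f [pT [g fg gf] mE]]].
have [rho [q [H oE]]] := polish_polish_metric (f point) pT.
exists (fun x y => rho (f x) (f y)), (g \o q); split.
  split=> [x|x y|x y|y x z|x e e0|u uc].
  - exact: pm_refl H _.
  - by move=> /(pm_eq0 H)/(can_inj fg).
  - exact: pm_sym H _ _.
  - exact: pm_tri H _ _ _.
  - by have [i xi] := pm_dense H (f x) e0; exists i; rewrite /= gf.
  - by have [l lP] := pm_complete H uc; exists (g l) => n; rewrite gf.
rewrite mE preimage_sigma_algebra oE; congr (<<s _ >>).
apply/seteqP; split=> [|O Oo].
  move=> _ [U Oo <-] x.
  rewrite setTI => Ox; have [e e0 eO] := Oo _ Ox.
  by exists e => // y /eO.
exists (g @^-1` O).
  move=> t Ot; have [e e0 eO] := Oo _ Ot.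
  by exists e => // s; rewrite -{1}(gf t) -{1}(gf s) => /eO.
by rewrite setTI; apply/seteqP; split=> x; rewrite /preimage /= fg.
Qed.

(** A copy of [T] indexed by the proof [H], so that the metric structure given by [H] is found by
    instance inference without touching other structures on [T]. *)
Definition metrized (R : realType) (T : choiceType) (rho : T -> T -> R)
  (q : nat -> T) (H : polish_metric rho q) : Type := T.

HB.instance Definition _ (R : realType) (T : choiceType) (rho : T -> T -> R)
  (q : nat -> T) (H : polish_metric rho q) := Choice.on (metrized H).

HB.instance Definition _ (R : realType) (T : choiceType) (rho : T -> T -> R)
    (q : nat -> T) (H : polish_metric rho q) :=
  isMetric.Build R (metrized H) (pm_refl H) (pm_eq0 H) (pm_sym H) (pm_tri H).

Section metrized.
Context (R : realType) (T : choiceType) (rho : T -> T -> R) (q : nat -> T).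
Context (H : polish_metric rho q).

Lemma metrized_open : @open (metrized H) = metric_open rho.
Proof.
apply/seteqP; split=> O.
  rewrite openE => Oo x Ox; have Nx : nbhs (x : metrized H) O := Oo _ Ox.
  have [e /= e0 eO] := (metricType_numDomainType.nbhs_mdistP _ _).1 Nx.
  by exists e => // y; exact: eO.
move=> Oo; rewrite openE => x /Oo[e e0 eO].
have H2 := @metricType_numDomainType.nbhs_mdistP R (metrized H) x O.
by apply: H2.2; exists e.
Qed.

(** Here the rate in [pm_complete] shows its use: a Cauchy filter contains a ball of radius 1/(n+1)
    for every n, and since any two of these balls meet, their centres are at distance at most
    1/(m+1) + 1/(n+1). *)
Lemma polish_metrized : polish R (metrized H).
Proof.
split.
  exists (range q); first exact: card_image_le.
  move=> O [x Ox]; rewrite metrized_open => /(_ _ Ox)[e e0 eO].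
  by have [i xi] := pm_dense H x e0; exists (q i); split; [exact: eO|exists i].
exists (metrized H), id, id; split=> //; try by move=> ?; exact: cvg_id.
move=> F FF Fcauchy; have Fc := (cauchyP F).1 Fcauchy.
have uP n : exists x, F (ball (x : metrized H) n.+1%:R^-1).
  by apply: Fc; rewrite invr_gt0.
have [u {}uP] := choice uP.
have [l lP] : exists l, forall n, rho (u n) l <= n.+1%:R^-1.
  apply: (pm_complete H) => m n.
  have [x [xm xn]] := filter_ex (filterI (uP m) (uP n)).
  apply: le_trans (pm_tri H x _ _) _; apply: lerD; apply: ltW.
    by move: xm; rewrite ballEmdist.
  by rewrite (pm_sym H); move: xn; rewrite ballEmdist.
exists l => A lA.
have [e /= e0 eA] := (metricType_numDomainType.nbhs_mdistP _ _).1 lA.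
have [n ne] := invn_lt (divr_gt0 e0 (ltr0n _ 2)).
apply: filterS (uP n) => x; rewrite ballEmdist/= => xn; apply: eA.
apply: le_lt_trans (pm_tri H (u n) _ _) _; rewrite [e]splitr.
by apply: ltrD; [rewrite (pm_sym H); exact: le_lt_trans (lP n) ne|exact: lt_trans xn ne].
Qed.

End metrized.

Lemma metric_standard_borel (R : realType) d (X : measurableType d)
    (rho : X -> X -> R) (q : nat -> X) :
  polish_metric rho q -> @measurable d X = <<s metric_open rho >> ->
  standard_borel R X.
Proof.
move=> H mE; exists (metrized H), id; split.
- exact: polish_metrized.
- by exists id.
- rewrite mE -[LHS]image_id metrized_open; apply/seteqP.
  by split=> _ [A mA <-]; exists A; rewrite ?setTI.
Qed.

(** * Estimates for sets of small measure *)

Section small_measure.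
Context (R : realType) d (X : measurableType d) (mu : probability X R).

Lemma decreasing_small_measure (D : nat -> set X) (e : R) :
  (forall n, measurable (D n)) -> (forall m n, (m <= n)%N -> D n `<=` D m) ->
  (forall x, exists n, ~ D n x) -> 0 < e -> exists n, (mu (D n) <= e%:E)%E.
Proof.
move=> mD dD D0 e0.
have DI : \bigcap_n D n = set0.
  by apply/seteqP; split=> // x Dx; have [n] := D0 x; apply; exact: Dx.
have cD : (mu \o D) n @[n --> \oo] --> (0 : \bar R)%E.
  rewrite -(measure0 mu) -DI; apply: nonincreasing_cvg_mu => //.
  - by rewrite (le_lt_trans (probability_le1 _ _))// ltry.
  - by rewrite DI; exact: measurable0.
  - by move=> m n mn; apply/subsetPset; exact: dD.
have nb : nbhs (0 : \bar R)%E [set y | (y < e%:E)%E].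
  by apply: open_nbhs_nbhs; split; [exact: open_ereal_lt_ereal|rewrite /= lte_fin].
by have [n _ /(_ n (leqnn n))/= /ltW] := cD _ nb; exists n.
Qed.

Lemma bigcup_small_measure (B : nat -> set X) (e : R) :
  0 <= e -> (forall n, measurable (B n)) ->
  (forall n, mu (B n) <= (e / (2 ^ n.+1)%:R)%:E)%E ->
  (mu (\bigcup_n B n) <= e%:E)%E.
Proof.
move=> e0 mB Be.
apply: le_trans (le_mu_bigcup _ mB (bigcupT_measurable _ mB)) _.
apply: le_trans (epsilon_trick0 xpredT e0).
by apply: lee_nneseries => // n _; exact: Be.
Qed.

Lemma measure_eq0 (A : set X) :
  (forall e : R, 0 < e -> (mu A <= e%:E)%E) -> mu A = 0%E.
Proof.
move=> Ae; apply/eqP; rewrite eq_le measure_ge0 andbT.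
by apply/lee_addgt0Pr => e e0; rewrite add0e; exact: Ae.
Qed.

Lemma setD_setI_measure (A B C : set X) (e1 e2 : R) :
  measurable A -> measurable B -> measurable C ->
  (mu (A `\` B) <= e1%:E)%E -> (mu (~` C) <= e2%:E)%E ->
  (mu (A `\` (B `&` C)) <= (e1 + e2)%:E)%E.
Proof.
move=> mA mB mC AB C2.
apply: (@le_trans _ _ (mu ((A `\` B) `|` ~` C))).
  apply: le_measure; rewrite ?inE.
  - by apply: measurableD => //; exact: measurableI.
  - by apply: measurableU; [exact: measurableD|exact: measurableC].
  - by move=> x [Ax /not_andP[Bx|Cx]]; [left|right].
rewrite EFinD; apply: le_trans (leeD AB C2).
by apply: measureU2; [exact: measurableD|exact: measurableC].
Qed.

End small_measure.

(** * Open and closed sets of a metric *)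

Definition metric_closed (R : realType) (T : Type) (rho : T -> T -> R)
  (F : set T) : Prop := metric_open rho (~` F).

Section metric_sets.
Context (R : realType) (T : Type) (rho : T -> T -> R) (q : nat -> T).
Hypothesis H : polish_metric rho q.

Lemma metric_open_ball x e : metric_open rho [set y | rho x y < e].
Proof.
move=> y /= xy; exists (e - rho x y); rewrite ?subr_gt0// => z yz.
by apply: le_lt_trans (pm_tri H y _ _) _; rewrite -ltrBrDl.
Qed.

Lemma metric_open_bigcup I (F : I -> set T) :
  (forall i, metric_open rho (F i)) -> metric_open rho (\bigcup_i F i).
Proof.
by move=> oF x [i _ /oF[e e0 eF]]; exists e => // y /eF; exists i.
Qed.

Lemma metric_openI (A B : set T) :
  metric_open rho A -> metric_open rho B -> metric_open rho (A `&` B).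
Proof.
move=> oA oB x [/oA[e e0 eA] /oB[f f0 fB]].
exists (Num.min e f); first by rewrite lt_min e0.
by move=> y; rewrite lt_min => /andP[/eA ? /fB ?].
Qed.

Lemma metric_closedU (A B : set T) : metric_closed rho A ->
  metric_closed rho B -> metric_closed rho (A `|` B).
Proof. by rewrite /metric_closed setCU; exact: metric_openI. Qed.

Lemma metric_closed_bigcupn (F : nat -> set T) n :
  (forall i, metric_closed rho (F i)) ->
  metric_closed rho [set x | exists2 i, (i < n)%N & F i x].
Proof.
move=> cF; elim: n => [|n IH].
  rewrite (_ : [set _ | _] = set0); last by apply/seteqP; split=> // x [].
  by rewrite /metric_closed setC0 => x _; exists 1.
rewrite (_ : [set _ | _] = [set x | exists2 i, (i < n)%N & F i x] `|` F n).
  exact: metric_closedU.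
apply/seteqP; split=> x /=.
  move=> [i]; rewrite ltnS leq_eqVlt => /predU1P[->|]; first by right.
  by left; exists i.
by move=> [[i ni Fi]|Fn]; [exists i => //; rewrite ltnS ltnW|exists n].
Qed.

Lemma metric_open_base O x : metric_open rho O -> O x ->
  exists i k, rho x (q i) < k.+1%:R^-1 /\
    forall y, rho y (q i) < k.+1%:R^-1 -> O y.
Proof.
move=> oO Ox; have [e e0 eO] := oO _ Ox.
have [k ke] := invn_lt (divr_gt0 e0 (ltr0n _ 2)).
have [|i xi] := pm_dense H x (e := k.+1%:R^-1); first by rewrite invr_gt0.
exists i, k; split=> // y yi; apply: eO.
apply: le_lt_trans (pm_tri H (q i) _ _) _; rewrite [e]splitr.
by apply: ltrD; [|rewrite (pm_sym H)]; exact: lt_trans ke.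
Qed.

Lemma metric_closed_limit F x : metric_closed rho F ->
  (forall e, 0 < e -> exists2 y, F y & rho x y < e) -> F x.
Proof.
move=> cF xF; apply: contrapT => /cF[e e0 eF].
by have [y Fy xy] := xF e e0; exact: eF xy Fy.
Qed.

End metric_sets.

(** * Generating and separating sequences *)

(** Each basic ball [A p] agrees mod 0 with a set [B p] of the generated sigma-algebra. Points at
    which all [f n] agree belong to the same [B p], hence, off the null set where some [A p] and
    [B p] differ, to the same balls, and are therefore at distance 0. *)
Lemma generates_separates (R : realType) d (X : measurableType d)
    (mu : probability X R) (f : nat -> X -> R) :
  standard_borel R X -> (forall n, measurable_fun setT (f n)) ->
  generates_mod0 mu f -> separates_points_mod0 mu f.
Proof.
move=> /standard_borel_metric[rho [q [H mX]]] mf gf.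
pose A (p : nat * nat) := [set y | rho (q p.1) y < p.2.+1%:R^-1].
have mA p : measurable (A p).
  by rewrite mX; apply: sub_sigma_algebra; exact: (metric_open_ball H).
have [B BP] := choice (fun p => (exists2P _ _).1 (gf _ (mA p))).
have mB p : measurable (B p).
  have [+ _] := BP p; apply: smallest_sub; first exact: sigma_algebra_measurable.
  by move=> _ [n _ [C mC <-]]; exact: mf.
have mN p : measurable (A p `+` B p).
  by rewrite /setY; apply: measurableU; exact: measurableD.
pose N := \bigcup_n (if unpickle n is Some p then A p `+` B p else set0).
have mN' : measurable N.
  by apply: bigcupT_measurable => n; case: unpickle => [p|//]; exact: mN.
exists (~` N); split; first exact: measurableC.
  rewrite probability_setC// (_ : mu N = 0%E) ?sube0//.
  apply: measure_eq0 => e e0; apply: bigcup_small_measure; first exact: ltW.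
    by move=> n; case: unpickle => [p|//]; exact: mN.
  move=> n; case: unpickle => [p|]; first rewrite (BP p).2.
    by rewrite lee_fin divr_ge0// ltW.
  by rewrite measure0 lee_fin divr_ge0// ltW.
move=> x x' Nx Nx' xx'; apply: contrapT => nfx; apply: xx'.
have fx n : f n x = f n x'.
  by apply: contrapT => nfn; apply: nfx; exists n.
have Bx p : B p x <-> B p x'.
  have [+ _] := BP p; move: (B p).
  apply: smallest_sub; last by move=> _ [n _ [C mC <-]]; rewrite /preimage /= fx.
  split=> // [C CP|C CP]; first by rewrite /setD/= CP.
  by split=> -[n _ /CP]; exists n.
have AB p y : ~ N y -> A p y <-> B p y.
  move=> Ny; have nAB : ~ (A p `+` B p) y.
    by move=> h; apply: Ny; exists (pickle p) => //; rewrite pickleK.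
  split=> h; apply: contrapT => h'; apply: nAB; [left|right]; exact: conj.
apply: (pm_eq0 H); apply/eqP; rewrite eq_le; apply/andP; split; last first.
  have := pm_tri H x' x x; rewrite (pm_refl H) (pm_sym H x' x).
  by rewrite -mulr2n pmulrn_lge0.
apply/ler_addgt0Pl => e e0; rewrite addr0.
have [k ke] := invn_lt (divr_gt0 e0 (ltr0n _ 2)).
have [|i xi] := pm_dense H x (e := k.+1%:R^-1); first by rewrite invr_gt0.
have Ax : A (i, k) x by rewrite /A/= (pm_sym H).
have /(AB _ _ Nx') Ax' := (Bx (i, k)).1 ((AB _ _ Nx).1 Ax).
apply: le_trans (pm_tri H (q i) _ _) _; rewrite [e]splitr.
by apply: lerD; apply: ltW; apply: lt_trans ke.
Qed.

(** * Regularity and tightness of Borel probability measures *)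

Section separates_generates.
Context (R : realType) d (X : measurableType d) (mu : probability X R).
Context (rho : X -> X -> R) (q : nat -> X).
Hypothesis H : polish_metric rho q.
Hypothesis mX : @measurable d X = <<s metric_open rho >>.

Lemma metric_open_measurable O : metric_open rho O -> measurable O.
Proof. by move=> oO; rewrite mX; exact: sub_sigma_algebra. Qed.

Lemma metric_closed_measurable F : metric_closed rho F -> measurable F.
Proof. by move=> cF; rewrite -(setCK F); apply/measurableC/metric_open_measurable. Qed.

Lemma metric_open_regular O (e : R) : metric_open rho O -> 0 < e ->
  exists F, [/\ metric_closed rho F, F `<=` O & (mu (O `\` F) <= e%:E)%E].
Proof.
move=> oO e0.
pose F n := [set x | forall y, rho x y < n.+1%:R^-1 -> O y].
have cF n : metric_closed rho (F n).
  move=> x /= /existsNP[y /not_implyP[xy nOy]].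
  exists (n.+1%:R^-1 - rho x y); first by rewrite subr_gt0.
  move=> z xz; apply/existsNP; exists y; apply/not_implyP; split=> //.
  by apply: le_lt_trans (pm_tri H x _ _) _; rewrite -ltrBrDr (pm_sym H).
have FO n : F n `<=` O by move=> x; apply; rewrite (pm_refl H) invr_gt0.
have [||x|n nP] := @decreasing_small_measure _ _ _ mu (fun n => O `\` F n) e _ _ _ e0.
- move=> n; apply: measurableD; first exact: metric_open_measurable.
  exact: metric_closed_measurable.
- move=> m n mn x [Ox nF]; split=> // Fm; apply: nF => y xy; apply: Fm.
  by apply: lt_le_trans xy _; rewrite lef_pV2 ?posrE// ler_nat.
- have [Ox|nOx] := pselect (O x); last by exists 0%N => -[].
  have [a a0 aO] := oO _ Ox; have [n na] := invn_lt a0.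
  by exists n => -[_]; apply => y xy; apply: aO; exact: lt_trans na.
- by exists (F n); split.
Qed.

(** Approximation is proved for a set and its complement together, which makes stability under
    complements immediate. For a countable union, finitely many of the closed sets already exhaust
    it up to half the error; for its complement, one intersects the closed sets, which needs no
    truncation. *)
Lemma measurable_regular A (e : R) : measurable A -> 0 < e ->
  exists F, [/\ metric_closed rho F, F `<=` A & (mu (A `\` F) <= e%:E)%E].
Proof.
pose reg B := forall e, 0 < e ->
  exists F, [/\ metric_closed rho F, F `<=` B & (mu (B `\` F) <= e%:E)%E].
suff : measurable `<=` [set B | [/\ measurable B, reg B & reg (~` B)]].
  by move=> + /[dup] mA => /[apply] -[_ + _] => /[apply].
rewrite {1}mX; apply: smallest_sub; last first.
  move=> O oO; split; first exact: metric_open_measurable.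
    by move=> a a0; exact: metric_open_regular.
  move=> a a0; exists (~` O); split=> //; last by rewrite setDv measure0 lee_fin ltW.
  by rewrite /metric_closed setCK.
have reg0 : reg set0.
  move=> a a0; exists set0; split=> //; last by rewrite setD0 measure0 lee_fin ltW.
  by rewrite /metric_closed setC0 => x _; exists 1.
have regT : reg setT.
  move=> a a0; exists setT; split=> //; last by rewrite setDv measure0 lee_fin ltW.
  by rewrite /metric_closed setCT => x [].
split; first by split=> //; rewrite setC0.
  by move=> B [mB rB rBC]; rewrite setTD; split; rewrite ?setCK//; exact: measurableC.
move=> B BP; have mB n : measurable (B n) by have [] := BP n.
split; first exact: bigcupT_measurable.
- move=> a a0.
  have a20 n : 0 < (a / 2) / (2 ^ n.+1)%:R :> R by rewrite !divr_gt0.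
  have [F FP] := choice (fun n => let: And3 _ r _ := BP n in r _ (a20 n)).
  have mF n : measurable (F n) by apply: metric_closed_measurable; have [] := FP n.
  pose G n := [set x | exists2 i, (i < n)%N & F i x].
  have cG n : metric_closed rho (G n).
    by apply: metric_closed_bigcupn => i; have [] := FP i.
  have mG n : measurable (G n) by exact: metric_closed_measurable.
  have [||x|n nP] := @decreasing_small_measure _ _ _ mu
      (fun n => (\bigcup_k F k) `\` G n) (a / 2) _ _ _ (divr_gt0 a0 (ltr0n _ 2)).
  + by move=> n; apply: measurableD => //; exact: bigcupT_measurable.
  + move=> m n mn x [Fx nG]; split=> // -[i im Fi]; apply: nG; exists i => //.
    exact: leq_trans im mn.
  + have [[n _ Fn]|nF] := pselect ((\bigcup_k F k) x); last by exists 0%N => -[].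
    by exists n.+1 => -[_]; apply; exists n.
  + exists (G n); split=> //.
      by move=> x [i _ Fi]; exists i => //; have [_ + _] := FP i; exact.
    apply: (@le_trans _ _ (mu ((\bigcup_k (B k `\` F k)) `|` ((\bigcup_k F k) `\` G n)))).
      apply: le_measure; rewrite ?inE.
      * by apply: measurableD => //; exact: bigcupT_measurable.
      * apply: measurableU; first by apply: bigcupT_measurable => k; exact: measurableD.
        by apply: measurableD => //; exact: bigcupT_measurable.
      * move=> x [[k _ Bx] nG]; have [Fx|nFx] := pselect (F k x).
          by right; split=> //; exists k.
        by left; exists k.
    rewrite [a]splitr EFinD; apply: le_trans (leeD (bigcup_small_measure _ _ _) nP).
    * apply: measureU2; first by apply: bigcupT_measurable => k; exact: measurableD.
      by apply: measurableD => //; exact: bigcupT_measurable.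
    * by rewrite divr_ge0// ltW.
    * by move=> k; exact: measurableD.
    * by move=> k; have [_ _] := FP k.
- move=> a a0; rewrite setC_bigcup.
  have a20 n : 0 < a / (2 ^ n.+1)%:R :> R by rewrite !divr_gt0.
  have [F FP] := choice (fun n => let: And3 _ _ r := BP n in r _ (a20 n)).
  have mF n : measurable (F n) by apply: metric_closed_measurable; have [] := FP n.
  exists (\bigcap_k F k); split.
  + rewrite /metric_closed setC_bigcap; apply: metric_open_bigcup => i.
    by have [] := FP i.
  + by move=> x Fx k _; have [_ + _] := FP k; apply; exact: Fx.
  + have mBF k : measurable (~` B k `\` F k) by apply: measurableD => //; exact: measurableC.
    apply: (@le_trans _ _ (mu (\bigcup_k (~` B k `\` F k)))).
      apply: le_measure; rewrite ?inE.
      * apply: measurableD; apply: bigcapT_measurable => // k; exact: measurableC.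
      * exact: bigcupT_measurable.
      * move=> x [Bx /existsNP[k /not_implyP[_ nF]]]; exists k => //; split=> //.
        exact: Bx.
    apply: bigcup_small_measure => //; first exact: ltW.
    by move=> k; have [_ _] := FP k.
Qed.


(** [K] is totally bounded but need not be closed. Limits of sequences in [K] come from completeness
    of the metric and may lie outside [K]. *)
Lemma measurable_tight (e : R) : 0 < e -> exists N : nat -> nat,
  let K := [set x | forall m, exists2 i, (i < N m)%N & rho x (q i) < m.+1%:R^-1] in
  measurable K /\ (mu (~` K) <= e%:E)%E.
Proof.
move=> e0.
pose D m n := ~` [set x | exists2 i, (i < n)%N & rho x (q i) < m.+1%:R^-1].
have mD m n : measurable (D m n).
  apply: measurableC; rewrite (_ : [set _ | _] =
      \bigcup_i [set x | (i < n)%N /\ rho x (q i) < m.+1%:R^-1]).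
    apply: bigcupT_measurable => i.
    have [ni|ni] := boolP (i < n)%N; last first.
      by rewrite (_ : [set _ | _] = set0)//; apply/seteqP; split=> // x [].
    apply: metric_open_measurable => x /= [_ xi].
    have := @metric_open_ball _ _ _ _ H (q i) m.+1%:R^-1 x.
    rewrite /= (pm_sym H) => /(_ xi)[a a0 aP]; exists a => // y /aP.
    by rewrite (pm_sym H).
  by apply/seteqP; split=> x /= [i]; [exists i|move=> _ []; exists i].
have DN m : exists n, (mu (D m n) <= (e / (2 ^ m.+1)%:R)%:E)%E.
  apply: decreasing_small_measure => [//|k l kl x|x|]; last by rewrite divr_gt0.
    by apply: subsetC => y [i ik yi]; exists i => //; exact: leq_trans kl.
  have [|i xi] := pm_dense H x (e := m.+1%:R^-1); first by rewrite invr_gt0.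
  by exists i.+1; apply; exists i.
have [N NP] := choice DN; exists N => K.
have KE : ~` K = \bigcup_m D m (N m).
  apply/seteqP; split=> x /=; first by move=> /existsNP[m mP]; exists m.
  by move=> [m _ mP] /(_ m).
split; last by rewrite KE; apply: bigcup_small_measure => //; exact: ltW.
by rewrite -(setCK K) KE; apply: measurableC; exact: bigcupT_measurable.
Qed.

End separates_generates.

(** A set that depends only on membership in finitely many [C k] is a finite union of atoms of the
    algebra they generate, however it was defined. This gives measurability to sets described by an
    existential quantifier over points, which are projections and not visibly Borel. *)
Lemma finite_pattern_measurable (T : Type) (C : nat -> set T) m (S : set T) :
  (forall x y, S x -> (forall k, (k < m)%N -> C k x <-> C k y) -> S y) ->
  <<s range C >> S.
Proof.
have sT := @smallest_sigma_algebra _ setT (range C).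
elim: m S => [|m IH] S SP.
  have [[x Sx]|/set0P/negP/negPn/eqP->] := pselect (S !=set0); last by case: sT.
  rewrite (_ : S = setT); last by apply/seteqP; split=> // y _; exact: SP Sx _.
  by case: sT => s0 sD _; have := sD _ s0; rewrite setD0.
(* [S1 True] and [S1 False] are the parts of [S] inside and outside [C m], saturated so as to forget
   [C m]; the induction hypothesis applies to them. *)
pose S1 b := [set x | exists z, [/\ S z, C m z <-> b &
  forall k, (k < m)%N -> C k z <-> C k x]].
have S1P b : <<s range C >> (S1 b).
  apply: IH => x y [z [Sz Cz zx]] xy; exists z; split=> // k km.
  exact: iff_trans (zx k km) (xy k km).
have CP : <<s range C >> (C m) by apply: sub_sigma_algebra; exists m.
have -> : S = (S1 True `&` C m) `|` (S1 False `\` C m).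
  apply/seteqP; split=> x.
    have [Cx|nCx] := pselect (C m x) => Sx; [left|right].
      by split=> //; exists x.
    by split=> //; exists x; split=> //; split=> // /nCx.
  move=> [[[z [Sz Cz zx]] Cx]|[[z [Sz Cz zx]] Cx]]; apply: (SP z x Sz) => k;
    rewrite ltnS leq_eqVlt => /predU1P[->|km].
  - by split=> // _; exact/Cz.
  - exact: zx.
  - by split=> [/Cz|/Cx].
  - exact: zx.
have sC A : <<s range C >> A -> <<s range C >> (~` A).
  by rewrite -setTD; case: sT => _ sD _; exact: sD.
have sU A B : <<s range C >> A -> <<s range C >> B -> <<s range C >> (A `|` B).
  move=> sA sB; rewrite -bigcup2E; case: sT => s0 _ sW; apply: sW => n.
  by rewrite /bigcup2; case: n => [|[|n]].
have sI A B : <<s range C >> A -> <<s range C >> B -> <<s range C >> (A `&` B).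
  by move=> sA sB; rewrite -(setCK (A `&` B)) setCI; apply: (sC); apply: sU; exact: (sC).
by apply: sU; [|rewrite setDE]; apply: sI => //; exact: sC.
Qed.

(** Serves to choose, along an ultrafilter of indices, one ball from each finite cover of a totally
    bounded set; this replaces the extraction of subsequences. *)
Lemma ultra_bounded_exists (T : Type) (F : set_system T) (FU : UltraFilter F)
    (P : nat -> set T) n :
  F [set x | exists2 i, (i < n)%N & P i x] -> exists2 i, (i < n)%N & F (P i).
Proof.
have PF : ProperFilter F by exact: ultra_proper.
elim: n => [|n IH] FP.
  by have [x []] := filter_ex FP.
have [FPn|FPn] := in_ultra_setVsetC (P n) FU; first by exists n.
have [|i ni FPi] := IH; last by exists i => //; exact: ltnW.
apply: filterS (filterI FP FPn) => x [[i]].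
rewrite ltnS leq_eqVlt => /predU1P[->//|ni Pi _]; by exists i.
Qed.

Section injective_generates.
Context (R : realType) d (X : measurableType d) (mu : probability X R).
Context (rho : X -> X -> R) (q : nat -> X).
Hypothesis H : polish_metric rho q.
Hypothesis mX : @measurable d X = <<s metric_open rho >>.

(* The compact set K is chosen so that every C k is relatively clopen in it:
   its saturation under the equivalence "same C k for all k" then meets E
   in K only. *)
Lemma injective_inner_approx (C : nat -> set X) (E A : set X) (e : R) :
  (forall k, measurable (C k)) -> measurable E -> measurable A ->
  (forall x x', E x -> E x' -> (forall k, C k x <-> C k x') -> x = x') ->
  0 < e -> exists S, [/\ <<s range C >> S, S `&` E `<=` A &
    (mu ((A `&` E) `\` S) <= e%:E)%E].
Proof.
move=> mC mE mA CE e0.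
(* One quarter for each of the sets [F], [K0], [K1] and [K2] whose intersection is [K]. *)
pose a := e / 4.
have a0 : 0 < a by rewrite divr_gt0.
have a20 n : 0 < a / (2 ^ n.+1)%:R :> R by rewrite !divr_gt0.
have [F [cF FA AF]] := measurable_regular mu H mX (measurableI _ _ mA mE) a0.
have [P PP] := choice (fun k => measurable_regular mu H mX (mC k) (a20 k)).
have [Q QP] := choice (fun k => measurable_regular mu H mX (measurableC (mC k)) (a20 k)).
have [N [mK muK]] := measurable_tight mu H mX a0.
have mF : measurable F := metric_closed_measurable mX cF.
have mP k : measurable (P k) by apply: (metric_closed_measurable mX); have [] := PP k.
have mQ k : measurable (Q k) by apply: (metric_closed_measurable mX); have [] := QP k.
set K0 := [set x | _] in mK muK.
pose K1 := ~` (\bigcup_k (C k `\` P k)).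
pose K2 := ~` (\bigcup_k (~` C k `\` Q k)).
have mCP k : measurable (C k `\` P k) by exact: measurableD.
have mCQ k : measurable (~` C k `\` Q k) by apply: measurableD => //; exact: measurableC.
have mK1 : measurable K1 by apply: measurableC; exact: bigcupT_measurable.
have mK2 : measurable K2 by apply: measurableC; exact: bigcupT_measurable.
pose K := F `&` K0 `&` K1 `&` K2.
have KP k x : K x -> C k x -> P k x.
  move=> [[_ K1x] _] Cx; apply: contrapT => nP; apply: K1x; by exists k.
have KQ k x : K x -> ~ C k x -> Q k x.
  move=> [_ K2x] Cx; apply: contrapT => nQ; apply: K2x; by exists k.
(* The witness z may vary with m: each set of the intersection is then a finite pattern and so
   measurable. A single witness for all k is recovered below as a limit. *)
pose sat := \bigcap_m [set x | exists2 z, K z & forall k, (k < m)%N -> C k z <-> C k x].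
have Ksat : K `<=` sat by move=> x Kx m _; exists x.
exists sat; split.
- rewrite -(setCK sat) setC_bigcap -setTD; apply: sigma_algebraCD.
  apply: sigma_algebra_bigcup => m; rewrite -setTD; apply: sigma_algebraCD.
  apply: (@finite_pattern_measurable _ _ m) => x y [z Kz zx] xy.
  by exists z => // k km; exact: iff_trans (zx k km) (xy k km).
- move=> x [sx Ex].
  have [z zP] := choice (fun m => (exists2P _ _).1 (sx m I)).
  have [U [UU UN]] := @ultraFilterLemma nat \oo _.
  have PU : ProperFilter U by exact: ultra_proper.
  have UU' n : U [set m | (n <= m)%N] by apply: UN; exists n.
  have ex m : exists j, U [set n | rho (z n) (q j) < m.+1%:R^-1].
    have [|j _ jP] := @ultra_bounded_exists _ _ UU
      (fun j => [set n | rho (z n) (q j) < m.+1%:R^-1]) (N m); last by exists j.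
    apply: filterS filterT => n _.
    by have [[[[_ K0z] _] _] _] := zP n; exact: K0z.
  have [i iP] := choice ex.
  have [l lP] : exists l, forall n, rho (q (i n)) l <= n.+1%:R^-1.
    apply: (pm_complete H) => m n.
    have [k [km kn]] := filter_ex (filterI (iP m) (iP n)).
    apply: le_trans (pm_tri H (z k) _ _) _; apply: lerD; apply: ltW => //.
    by rewrite (pm_sym H).
  have closed_l B : metric_closed rho B -> U [set n | B (z n)] -> B l.
    move=> cB UB; apply: (metric_closed_limit cB) => b b0.
    have [m mb] := invn_lt (divr_gt0 b0 (ltr0n _ 2)).
    have [k [Bk km]] := filter_ex (filterI UB (iP m)).
    exists (z k) => //; apply: le_lt_trans (pm_tri H (q (i m)) _ _) _.
    rewrite [b]splitr; apply: ltrD; rewrite (pm_sym H).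
      exact: le_lt_trans (lP m) mb.
    exact: lt_trans km mb.
  have Fl : F l.
    apply: (closed_l _ cF); apply: filterS filterT => n _.
    by have [[[[]]]] := zP n.
  (* The limit [l] lies in the closed set [F], hence in A and E. On [K] membership in [C k] is
     decided by the closed sets [P k] and [Q k], so it passes to the limit; [l] and [x] then have
     the same pattern, and injectivity on E gives [l = x]. *)
  have [Al El] := FA _ Fl.
  rewrite -(CE l x) // => k.
  have zC : U [set n | C k (z n) <-> C k x].
    by apply: filterS (UU' k.+1) => n /= kn; have [_] := zP n; apply.
  split=> Ck; last first.
    have [_ PC _] := PP k; apply: PC; apply: closed_l; first by have [] := PP k.
    by apply: filterS zC => n /= [_ /(_ Ck)]; apply: KP; have [] := zP n.
  apply: contrapT => nCk; have [_ QC _] := QP k.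
  apply: (QC l) Ck; apply: closed_l; first by have [] := QP k.
  apply: filterS zC => n /= [zx _]; apply: KQ; first by have [] := zP n.
  by move=> /zx.
- apply: (@le_trans _ _ (mu ((A `&` E) `\` K))).
    apply: le_measure; rewrite ?inE.
    + apply: measurableD; first exact: measurableI.
      apply: bigcapT_measurable => m.
      have : <<s range C >> [set x | exists2 z, K z & forall k, (k < m)%N -> C k z <-> C k x].
        apply: (@finite_pattern_measurable _ _ m) => x y [z Kz zx] xy.
        by exists z => // k km; exact: iff_trans (zx k km) (xy k km).
      apply: smallest_sub; first exact: sigma_algebra_measurable.
      by move=> _ [k _ <-].
    + apply: measurableD; first exact: measurableI.
      by do 3 (apply: measurableI => //).
    + by move=> x [AEx nsx]; split=> // /Ksat.
  rewrite (_ : e = a + a + a + a); last by rewrite /a; lra.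
  have small D : (forall k, measurable (D k)) ->
      (forall k, (mu (D k) <= (a / (2 ^ k.+1)%:R)%:E)%E) ->
      (mu (~` ~` \bigcup_k D k) <= a%:E)%E.
    by move=> mD DP; rewrite setCK; apply: bigcup_small_measure => //; exact: ltW.
  have mAE : measurable (A `&` E) by exact: measurableI.
  have mF0 : measurable (F `&` K0) by exact: measurableI.
  have mF1 : measurable (F `&` K0 `&` K1) by exact: measurableI.
  apply: setD_setI_measure => //; last by apply: small => // k; have [_ _] := QP k.
  apply: setD_setI_measure => //; last by apply: small => // k; have [_ _] := PP k.
  exact: setD_setI_measure.
Qed.

End injective_generates.

(** The rational sublevel sets of the [f n] form a countable family separating the points of E. The
    inner approximations [S j] of [A] never leave [A] within E, so their union does not either, and
    what it misses of [A] within E has measure at most 1/(j+1) for every j. *)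
Lemma separates_generates (R : realType) d (X : measurableType d)
    (mu : probability X R) (f : nat -> X -> R) :
  standard_borel R X -> (forall n, measurable_fun setT (f n)) ->
  separates_points_mod0 mu f -> generates_mod0 mu f.
Proof.
move=> /standard_borel_metric[rho [q [H mX]]] mf [E [mE muE fE]] A mA.
pose C n : set X := if unpickle n is Some p
  then f p.1 @^-1` `]-oo, (ratr p.2 : R)[%classic else set0.
have sC n : <<s \bigcup_n preimage_set_system [set: X] (f n) measurable >> (C n).
  rewrite /C; case: unpickle => [p|]; last exact: sigma_algebra0.
  by apply: sub_sigma_algebra; exists p.1 => //; exists `]-oo, (ratr p.2 : R)[%classic => //;
    rewrite setTI.
have sR : <<s range C >> `<=` <<s \bigcup_n preimage_set_system [set: X] (f n) measurable >>.
  apply: smallest_sub; first exact: smallest_sigma_algebra.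
  by move=> _ [n _ <-].
have sm : <<s \bigcup_n preimage_set_system [set: X] (f n) measurable >> `<=` @measurable d X.
  apply: smallest_sub; first exact: sigma_algebra_measurable.
  by move=> _ [n _ [D mD <-]]; exact: mf.
have CE x x' : E x -> E x' -> (forall k, C k x <-> C k x') -> x = x'.
  move=> Ex Ex' CC; apply: contrapT => /(fE _ _ Ex Ex')[n fn].
  have CC' (r : rat) : f n x < ratr r <-> f n x' < ratr r.
    have := CC (pickle (n, r)); rewrite /C pickleK /preimage /=.
    by rewrite !in_itv.
  have := fn; have [lt_f|lt_f|->//] := ltgtP (f n x) (f n x').
    have [r] := rat_in_itvoo lt_f; rewrite in_itv/= => /andP[xr rx'] _.
    by have := lt_trans rx' ((CC' r).1 xr); rewrite ltxx.
  have [r] := rat_in_itvoo lt_f; rewrite in_itv/= => /andP[xr rx'] _.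
  by have := lt_trans rx' ((CC' r).2 xr); rewrite ltxx.
have ex j : exists S, [/\ <<s range C >> S, S `&` E `<=` A &
    (mu ((A `&` E) `\` S) <= (j.+1%:R^-1)%:E)%E].
  apply: (@injective_inner_approx _ _ _ _ _ _ H mX) => //.
  by move=> k; exact: sm.
have [S SP] := choice ex.
have mS j : measurable (S j) by have [sS _ _] := SP j; exact: sm _ (sR _ sS).
exists (\bigcup_j S j).
  by apply: sigma_algebra_bigcup => j; apply: sR; have [] := SP j.
have mSU : measurable (\bigcup_j S j) by exact: bigcupT_measurable.
have muCE : mu (~` E) = 0%E by rewrite probability_setC// muE subee.
have mAE : measurable (A `&` E) by exact: measurableI.
apply: (@subset_measure0 _ _ _ _ _ (~` E `|` ((A `&` E) `\` \bigcup_j S j))).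
- by rewrite /setY; apply: measurableU; exact: measurableD.
- by apply: measurableU; [exact: measurableC|exact: measurableD].
- move=> x; have [Ex|nEx] := pselect (E x); last by left.
  move=> [[Ax nS]|[[j _ Sx] nA]]; first by right.
  by have [_ + _] := SP j => /(_ x) SA; case: nA; exact: SA.
- suff AES : mu ((A `&` E) `\` \bigcup_j S j) = 0%E.
    apply/eqP; rewrite eq_le measure_ge0 andbT.
    have AE0 : (mu (~` E) + mu ((A `&` E) `\` \bigcup_j S j) <= 0)%E.
      by rewrite muCE AES adde0.
    apply: le_trans AE0; apply: measureU2; first exact: measurableC.
    exact: measurableD.
  apply: measure_eq0 => e e0; have [j je] := invn_lt e0.
  have [_ _ muj] := SP j.
  apply: (@le_trans _ _ (j.+1%:R^-1)%:E); last by rewrite lee_fin ltW.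
  apply: le_trans muj; apply: le_measure; rewrite ?inE; try exact: measurableD.
  by move=> x [Ax nS]; split=> // Sx; apply: nS; exists j.
Qed.

(** * Baire category *)

Definition nowhere_dense_set (T : topologicalType) (N : set T) : Prop :=
  forall U, open U -> U !=set0 ->
    exists V, [/\ open V, V !=set0, V `<=` U & forall x, V x -> ~ N x].

Definition meager (T : topologicalType) (E : set T) : Prop :=
  exists2 N : nat -> set T, (forall n, nowhere_dense_set (N n)) &
    E `<=` \bigcup_n N n.

(* For Borel sets this replaces the Baire property: every nonempty open set
   has a nonempty open subset in which [E] is meager or comeager. *)
Definition locally_decided (T : topologicalType) (E : set T) : Prop :=
  forall U, open U -> U !=set0 ->
    exists V, [/\ open V, V !=set0, V `<=` U &
      meager (V `&` E) \/ meager (V `\` E)].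

Section meager_topological.
Context (T : topologicalType).
Implicit Types E U V : set T.

Lemma nowhere_dense_set0 : nowhere_dense_set (set0 : set T).
Proof. by move=> U oU U0; exists U; split=> // x _ []. Qed.

Lemma meagerS E E' : E' `<=` E -> meager E -> meager E'.
Proof. by move=> EE [N nN EN]; exists N => //; exact: subset_trans EN. Qed.

Lemma meager0 : meager (set0 : set T).
Proof. by exists (fun=> set0) => // _; exact: nowhere_dense_set0. Qed.

Lemma nowhere_dense_meager E : nowhere_dense_set E -> meager E.
Proof. by move=> nE; exists (fun=> E) => // x Ex; exists 0%N. Qed.

Lemma meager_bigcup (E : nat -> set T) :
  (forall n, meager (E n)) -> meager (\bigcup_n E n).
Proof.
move=> mE; have [N NP] := choice (fun n => (exists2P _ _).1 (mE n)).
exists (fun n => if unpickle n is Some p then N p.1 p.2 else set0).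
  move=> n; case: unpickle => [p|]; last exact: nowhere_dense_set0.
  by have [nN _] := NP p.1; exact: nN.
move=> x [n _ Ex]; have [_ /(_ x Ex)[m _ Nx]] := NP n.
by exists (pickle (n, m)) => //; rewrite pickleK.
Qed.

Lemma meagerU E E' : meager E -> meager E' -> meager (E `|` E').
Proof.
move=> mE mE'; rewrite -bigcup2E; apply: meager_bigcup => n.
by rewrite /bigcup2; case: n => [|[|n]] //=; exact: meager0.
Qed.

Lemma locally_decided_setC E : locally_decided E -> locally_decided (~` E).
Proof.
move=> dE U oU U0; have [V [oV V0 VU VE]] := dE U oU U0.
by exists V; split=> //; rewrite setDE setCK -setDE; case: VE; [right|left].
Qed.

Lemma open_locally_decided E : open E -> locally_decided E.
Proof.
move=> oE U oU U0; have [UE|UE] := pselect (U `&` E !=set0).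
  exists (U `&` E); split=> //; first exact: openI.
  by right; rewrite -setIDA setDv setI0; exact: meager0.
exists U; split=> //; left; move/set0P/negP/negPn/eqP: UE => ->.
exact: meager0.
Qed.

End meager_topological.

Definition metric_base (R : realType) (T : Type) (rho : T -> T -> R)
    (q : nat -> T) (n : nat) : set T :=
  if unpickle n is Some p then [set y | rho (q p.1) y < p.2.+1%:R^-1] else set0.

Section baire_category.
Context (R : realType) (T : topologicalType) (rho : T -> T -> R) (q : nat -> T).
Hypothesis H : polish_metric rho q.
Hypothesis oE : @open T = metric_open rho.
Implicit Types E U V : set T.

Lemma metric_base_open n : open (metric_base rho q n).
Proof.
rewrite /metric_base; case: unpickle => [p|]; last exact: open0.
by rewrite oE; exact: (metric_open_ball H).
Qed.

Lemma metric_baseP U x : open U -> U x ->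
  exists n, metric_base rho q n x /\ metric_base rho q n `<=` U.
Proof.
rewrite oE => oU Ux; have [i [k [xi iU]]] := metric_open_base H oU Ux.
exists (pickle (i, k)); rewrite /metric_base pickleK; split.
  by rewrite /= (pm_sym H).
by move=> y /= yi; apply: iU; rewrite (pm_sym H).
Qed.

(** Banach's category theorem. The basic open sets on which E is meager are countably many, so E is
    meager on their union [D]; by hypothesis [D] meets every nonempty open subset of U in a nonempty
    open set, so that [U \ D] is nowhere dense. *)
Lemma meager_localization E U : open U ->
  (forall V, open V -> V !=set0 -> V `<=` U ->
    exists W, [/\ open W, W !=set0, W `<=` V & meager (W `&` E)]) ->
  meager (U `&` E).
Proof.
move=> oU UE.
pose I n := metric_base rho q n `<=` U /\ meager (metric_base rho q n `&` E).
pose D := \bigcup_(n in I) metric_base rho q n.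
apply: (@meagerS _ ((U `\` D) `|` \bigcup_n
    (if `[< I n >] then metric_base rho q n `&` E else set0))).
  move=> x [Ux Ex]; have [[n In nx]|nD] := pselect (D x); last by left.
  by right; exists n => //; rewrite asboolT.
apply: meagerU; last first.
  by apply: meager_bigcup => n; case: asboolP => [In|_]; [exact: In.2|exact: meager0].
apply: nowhere_dense_meager => V oV [x Vx].
have [UV|UV] := pselect (V `&` U !=set0); last first.
  exists V; split=> //; first by exists x.
  by move=> y Vy [Uy _]; apply: UV; exists y.
have [W [oW [y Wy] WV mW]] := UE (V `&` U) (openI oV oU) UV (@subIsetr _ _ _).
have [n [ny nW]] := metric_baseP oW Wy.
exists (metric_base rho q n); split.
- exact: metric_base_open.
- by exists y.
- by move=> z /nW/WV[].
- move=> z nz [_]; apply; exists n => //; split.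
    by move=> w /nW/WV[].
  by apply: meagerS mW => w [/nW].
Qed.

(** Baire's theorem by nested balls: [s n] is a pair of centre and radius, and the closed ball of
    [s n.+1] lies in the open ball of [s n] and avoids [N n]. *)
Lemma open_nonmeager U : open U -> U !=set0 -> ~ meager U.
Proof.
move=> oU [x0 Ux0] [N nN UN].
have [r0 r00 r0U] : exists2 r, 0 < r & forall y, rho x0 y < r -> U y.
  by move: oU; rewrite oE => /(_ _ Ux0).
have stepE (n : nat) (s : T * R) : exists t : T * R, 0 < s.2 ->
    [/\ 0 < t.2, t.2 <= n.+1%:R^-1 & forall y, rho t.1 y <= t.2 ->
      rho s.1 y < s.2 /\ ~ N n y].
  have [s0|s0] := boolP (0 < s.2); last by exists s.
  have oB : open [set y | rho s.1 y < s.2] by rewrite oE; exact: (metric_open_ball H).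
  have [|V [oV [z Vz] VB VN]] := nN n _ oB; first by exists s.1; rewrite /= (pm_refl H).
  have [e e0 eV] : exists2 r, 0 < r & forall y, rho z y < r -> V y.
    by move: oV; rewrite oE => /(_ _ Vz).
  (* Halving [e] keeps the closed ball inside [V]; the bound 1/(n+1) makes the centres converge at
     the rate required by completeness. *)
  exists (z, Num.min (e / 2) n.+1%:R^-1) => _ /=; split.
  - by rewrite lt_min divr_gt0//= invr_gt0.
  - by rewrite ge_min lexx orbT.
  - move=> y; rewrite le_min => /andP[ye _]; have Vy : V y.
      by apply: eV; apply: le_lt_trans ye _; rewrite ltr_pdivrMr// mulr_natr mulr2n ltrDl.
    by split; [exact: VB|exact: VN].
have [step stepP] := choice (fun ns : nat * (T * R) => stepE ns.1 ns.2).
pose s := fix s n := if n is m.+1 then step (m, s m) else (x0, r0).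
have s0 n : 0 < (s n).2.
  by elim: n => //= n IH; have [] := stepP (n, s n) IH.
have sS n : [/\ 0 < (s n.+1).2, (s n.+1).2 <= n.+1%:R^-1 &
    forall y, rho (s n.+1).1 y <= (s n.+1).2 ->
      rho (s n).1 y < (s n).2 /\ ~ N n y] := stepP (n, s n) (s0 n).
have sD m k y : rho (s (m + k)%N).1 y <= (s (m + k)%N).2 -> rho (s m).1 y <= (s m).2.
  elim: k => [|k IH]; first by rewrite addn0.
  rewrite addnS => /(let: And3 _ _ h := sS (m + k)%N in h y)[/ltW ? _]; exact: IH.
have sle m n : (m <= n)%N -> rho (s m).1 (s n).1 <= (s m).2.
  move=> mn; apply: (sD m (n - m)%N); rewrite subnKC// (pm_refl H).
  exact: ltW.
have [l lP] : exists l, forall n, rho (s n.+1).1 l <= n.+1%:R^-1.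
  apply: (pm_complete H) => m n.
  have le m' n' : (m' <= n')%N -> rho (s m'.+1).1 (s n'.+1).1 <= m'.+1%:R^-1.
    move=> mn; apply: le_trans (sle _ _ _) _; first by rewrite ltnS.
    by have [] := sS m'.
  have [mn|nm] := leqP m n.
    by apply: le_trans (le _ _ mn) _; rewrite lerDl invr_ge0.
  by rewrite (pm_sym H); apply: le_trans (le _ _ (ltnW nm)) _; rewrite lerDr invr_ge0.
have ls m : rho (s m).1 l <= (s m).2.
  apply/ler_addgt0Pl => e e0; have [n ne] := invn_lt e0.
  apply: le_trans (pm_tri H (s (maxn m n).+1).1 _ _) _; rewrite addrC; apply: lerD.
    apply: le_trans (lP _) _; apply: ltW; apply: le_lt_trans ne.
    by rewrite lef_pV2 ?posrE// ler_nat ltnS leq_maxr.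
  by apply: sle; rewrite leqW// leq_maxl.
have Ul : U l by apply: r0U; have [_ _ /(_ l (ls 1%N))[]] := sS 0%N.
have [n _ Nl] := UN l Ul.
by have [_ _ /(_ l (ls n.+1))[]] := sS n.
Qed.

(** Either some [E n] is comeager in a nonempty open part of [U], and so is the union, or by
    localization every [E n] is meager in [U], and so is the union. *)
Lemma locally_decided_bigcup (E : nat -> set T) :
  (forall n, locally_decided (E n)) -> locally_decided (\bigcup_n E n).
Proof.
move=> dE U oU U0.
have [[n [V [oV V0 VU mV]]]|nex] := pselect (exists n V,
    [/\ open V, V !=set0, V `<=` U & meager (V `\` E n)]).
  exists V; split=> //; right; apply: meagerS mV => x [Vx nE]; split=> // Ex.
  by apply: nE; exists n.
exists U; split=> //; left; rewrite setI_bigcupr; apply: meager_bigcup => n.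
apply: meager_localization => // V oV V0 VU.
have [W [oW W0 WV [mW|mW]]] := dE n V oV V0; first by exists W.
by case: nex; exists n, W; split=> //; exact: subset_trans WV VU.
Qed.

Lemma borel_locally_decided : <<s @open T >> `<=` @locally_decided T.
Proof.
apply: smallest_sub; last by move=> E; exact: open_locally_decided.
split.
- exact: open_locally_decided open0.
- by move=> E; rewrite setTD; exact: locally_decided_setC.
- exact: locally_decided_bigcup.
Qed.

Lemma nonmeager_comeager E U : open U -> locally_decided E ->
  ~ meager (U `&` E) ->
  exists V, [/\ open V, V !=set0, V `<=` U & meager (V `\` E)].
Proof.
move=> oU dE nUE; apply: contrapT => nex; apply: nUE.
apply: meager_localization => // V oV V0 VU.
have [W [oW W0 WV [mW|mW]]] := dE V oV V0; first by exists W.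
by case: nex; exists W; split=> //; exact: subset_trans WV VU.
Qed.

End baire_category.

(** * Vaught transforms *)

Section group_topology.
Context (G : topologicalGroupType).
Implicit Types U V : set G.

Lemma open_mulgr U (g : G) : open U -> open [set h | U (h * g)%g].
Proof.
move=> oU; rewrite openE => h /= Uhg; rewrite /interior /=.
have cg : {for (h, g), continuous (fun gh : G * G => (gh.1 * gh.2)%g)}.
  exact: mulg_continuous.
have [[A B] [/= Ah Bg] AB] := cg U (open_nbhs_nbhs (conj oU Uhg)).
apply: filterS Ah => x Ax; apply: (AB (x, g)); split=> //=.
exact: nbhs_singleton Bg.
Qed.

Lemma open_mulgl U (g : G) : open U -> open [set h | U (g * h)%g].
Proof.
move=> oU; rewrite openE => h /= Uhg; rewrite /interior /=.
have cg : {for (g, h), continuous (fun gh : G * G => (gh.1 * gh.2)%g)}.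
  exact: mulg_continuous.
have [[A B] [/= Ag Bh] AB] := cg U (open_nbhs_nbhs (conj oU Uhg)).
apply: filterS Bh => x Bx; apply: (AB (g, x)); split=> //=.
exact: nbhs_singleton Ag.
Qed.

Lemma open_invg U : open U -> open [set h : G | U (h^-1)%g].
Proof. by move=> oU; apply: (open_comp (in1W (@invg_continuous G))). Qed.

Lemma open_mulg_split U (g h : G) : open U -> U (g * h)%g ->
  exists A B, [/\ open A, A g, open B, B h &
    forall x y, A x -> B y -> U (x * y)%g].
Proof.
move=> oU Ugh.
have cg : {for (g, h), continuous (fun gh : G * G => (gh.1 * gh.2)%g)}.
  exact: mulg_continuous.
have [[A B] [/= Ag Bh] AB] := cg U (open_nbhs_nbhs (conj oU Ugh)).
exists A^°, B^°; split; try exact: open_interior; try by [].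
by move=> x y /interior_subset Ax /interior_subset By; exact: (AB (x, y)).
Qed.

(** The product set UV, written as a union of right translates of U, from which openness needs only
    U to be open. *)
Definition mulset U V : set G := [set g | exists2 v, V v & U (g * v^-1)%g].

Lemma mulset_open U V : open U -> open (mulset U V).
Proof.
move=> oU; rewrite (_ : mulset U V = \bigcup_(v in V) [set g | U (g * v^-1)%g]) //.
by apply: bigcup_open => v _; exact: open_mulgr.
Qed.

Lemma mulsetP U V g v : U g -> V v -> mulset U V (g * v)%g.
Proof. by move=> Ug Vv; exists v; rewrite // -mulgA mulgV mulg1. Qed.

Lemma meager_mulgr (E : set G) (g : G) :
  meager E -> meager [set h | E (h * g)%g].
Proof.
move=> [N nN EN]; exists (fun n => [set h | N n (h * g)%g]); last first.
  by move=> h /= /EN[n _ Nh]; exists n.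
move=> n U oU [x Ux].
have [||V [oV [y Vy] VU VN]] := nN n [set h | U (h * g^-1)%g].
- exact: open_mulgr.
- by exists (x * g)%g; rewrite /= -mulgA mulgV mulg1.
exists [set h | V (h * g)%g]; split.
- exact: open_mulgr.
- by exists (y * g^-1)%g; rewrite /= -mulgA mulVg mulg1.
- by move=> h /= /VU /=; rewrite -mulgA mulgV mulg1.
- by move=> h /= /VN.
Qed.

End group_topology.

Section vaught_transform.
Context (R : realType) (G : topologicalGroupType) (rho : G -> G -> R) (q : nat -> G).
Hypothesis H : polish_metric rho q.
Hypothesis oE : @open G = metric_open rho.
Context d (Y : measurableType d) (b : G -> Y -> Y).
Hypothesis mb : borel_action b.

(** Local decision of the sections is carried along because the complement step of the induction
    depends on it. *)
Let decided_nonmeager (A : set (borel_group G * Y)) : Prop :=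
  (forall y, locally_decided [set g : G | A (g, y)]) /\
  (forall U, open U -> measurable [set y | ~ meager (U `&` [set g : G | A (g, y)])]).

(* Montgomery-Novikov: the category quantifier preserves Borel sets. *)
Lemma measurable_nonmeager_section (A : set (borel_group G * Y)) :
  measurable A -> decided_nonmeager A.
Proof.
rewrite measurable_prod_measurableType; move: A; apply: smallest_sub; last first.
  move=> _ [C mC [D mD <-]].
  have sec y : [set g : G | (C `*` D) (g, y)] = [set g | C g /\ D y] by [].
  split=> [y|U oU].
    rewrite sec; have [Dy|nDy] := pselect (D y).
      rewrite (_ : [set _ | _] = C); last by apply/seteqP; split=> // x [].
      exact: (borel_locally_decided H oE).
    rewrite (_ : [set _ | _] = set0); last by apply/seteqP; split=> // x [].
    exact: open_locally_decided open0.
  have [mUC|nUC] := pselect (meager (U `&` (C : set G))).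
    rewrite (_ : [set _ | _] = set0)//; apply/seteqP; split=> // y /=; apply.
    by apply: meagerS mUC => g [Ug [Cg _]].
  rewrite (_ : [set _ | _] = D)//; apply/seteqP; split=> y /= => [nm|Dy mm].
    apply: contrapT => nDy; apply: nm; apply: meagerS (@meager0 _) => g [_ []].
    by [].
  by apply: nUC; apply: meagerS mm => g [Ug Cg].
split.
- split=> [y|U oU].
    by apply: open_locally_decided; exact: open0.
  rewrite (_ : [set _ | _] = set0)//; apply/seteqP; split=> // y /=; apply.
  by apply: meagerS (@meager0 _) => g [].
- move=> A [dA mA]; rewrite setTD; split=> [y|U oU].
    exact: (locally_decided_setC (dA y)).
  (* For a locally decided section, the complement is nonmeager in U exactly when the section is
     meager in some nonempty basic open subset of U. The quantifier over open sets thus becomes a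
     countable union of complements. *)
  rewrite (_ : [set _ | _] = \bigcup_n (if
      `[< metric_base rho q n !=set0 /\ metric_base rho q n `<=` U >]
      then ~` [set y | ~ meager (metric_base rho q n `&` [set g : G | A (g, y)])]
      else set0)).
    apply: bigcupT_measurable => n; case: ifP => _ //; apply: measurableC.
    exact/mA/(metric_base_open H oE).
  apply/seteqP; split=> y /=.
    move=> /(nonmeager_comeager H oE oU (locally_decided_setC (dA y))).
    move=> [V [oV [g Vg] VU mV]]; have [n [ng nV]] := metric_baseP H oE oV Vg.
    exists n => //; rewrite asboolT; last first.
      by split; [exists g|exact: subset_trans VU].
    apply; apply: meagerS mV => h [/nV Vh Ah]; split=> //=; exact.
  move=> [n _]; case: asboolP => [[n0 nU]|//] /contrapT mn mU.
  apply: (open_nonmeager H oE (metric_base_open H oE n) n0).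
  apply: meagerS (meagerU mn mU) => g ng.
  have [Ag|nAg] := pselect (A (g, y)); first by left.
  by right; split; [exact: nU|].
- move=> A PA; split=> [y|U oU].
    rewrite (_ : [set _ | _] = \bigcup_n [set g : G | A n (g, y)]).
      by apply: (locally_decided_bigcup H oE) => n; have [] := PA n.
    by [].
  rewrite (_ : [set _ | _] =
      \bigcup_n [set y | ~ meager (U `&` [set g : G | A n (g, y)])]).
    by apply: bigcupT_measurable => n; have [_ mn] := PA n; exact: mn.
  apply/seteqP; split=> y /=.
    move=> nm; apply: contrapT => nex; apply: nm.
    rewrite (_ : _ `&` _ = \bigcup_n (U `&` [set g : G | A n (g, y)])).
      apply: meager_bigcup => n; apply: contrapT => nm; apply: nex.
      by exists n.
    apply/seteqP; split=> g; first by move=> [Ug [n _ Ag]]; exists n.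
    by move=> [n _ [Ug Ag]]; split=> //; exists n.
  move=> [n _ nm] mm; apply: nm; apply: meagerS mm => g [Ug Ag]; split=> //.
  by exists n.
Qed.

Definition vaught (S : set Y) (B : set G) : set Y :=
  [set y | ~ meager (B `&` [set g | S (b g y)])].

Lemma measurable_vaught S B : measurable S -> open B -> measurable (vaught S B).
Proof.
move=> mS oB.
have mA : measurable ((fun gx : borel_group G * Y => b gx.1 gx.2) @^-1` S).
  by rewrite -[X in measurable X]setTI; exact: mb.
by have [_ mBA] := measurable_nonmeager_section mA; exact: mBA.
Qed.

Lemma locally_decided_orbit S y : measurable S ->
  locally_decided [set g | S (b g y)].
Proof.
move=> mS.
have mA : measurable ((fun gx : borel_group G * Y => b gx.1 gx.2) @^-1` S).
  by rewrite -[X in measurable X]setTI; exact: mb.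
by have [dA _] := measurable_nonmeager_section mA; exact: dA.
Qed.

Lemma vaughtS S B B' : B `<=` B' -> vaught S B `<=` vaught S B'.
Proof.
by move=> BB y nm mm; apply: nm; apply: meagerS mm => g [/BB].
Qed.

Hypothesis bM : forall g h y, b g (b h y) = b (g * h)%g y.

(** Replacing y by [b g y] translates the set of all h with [S (b h y)] on the right by [g^-1], and
    right translations preserve meagerness. *)
Lemma vaught_shift S B B' g y : (forall h, B h -> B' (h * g^-1)%g) ->
  vaught S B y -> vaught S B' (b g y).
Proof.
move=> BB nm mm; apply: nm.
apply: meagerS (meager_mulgr (g^-1)%g mm) => h [Bh Sh]; split; first exact: BB.
by rewrite /= bM -mulgA mulVg mulg1.
Qed.

End vaught_transform.

(** * Uniformly continuous functions on a spatial model *)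

Lemma measurable_fun_sublevel (R : realType) d (X : measurableType d) (f : X -> R) :
  (forall r, measurable [set x | f x < r]) -> measurable_fun setT f.
Proof.
move=> mf; apply: (measurability _ (RGenInftyO.measurableE R)) => _ [_ [r ->] <-].
by rewrite setTI (_ : _ @^-1` _ = [set x | f x < r]).
Qed.

(** * Dyadic chains of open sets in a group *)

Section dyadic_chain.
Context (G : topologicalGroupType) (V : nat -> set G).
Hypothesis oV : forall n, open (V n).
Hypothesis V1 : forall n, V n 1%g.
Hypothesis VV : forall n x y, V n.+1 x -> V n.+1 y -> V n (x * y)%g.
Variable O : set G.
Hypothesis oO : open O.

(* [dyadic n k] stands for the set at height k / 2^n in an increasing chain
   starting from O, in which translation by V n moves up by at most 1 / 2^n. *)
Fixpoint dyadic (n k : nat) : set G :=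
  match n with
  | 0 => if k is k'.+1 then if k' is 0 then mulset O (V 0%N) else setT else O
  | n'.+1 => if odd k then mulset (dyadic n' k./2) (V n) else dyadic n' k./2
  end.

Lemma dyadic_open n k : open (dyadic n k).
Proof.
elim: n k => [|n IH] k /=; last by case: odd; [exact: mulset_open|].
by case: k => [|[|k]]//; [exact: mulset_open|exact: openT].
Qed.

(** For odd k at level n+1, g already ends with a factor [w] in [V n.+1]; it merges with v into an
    element of [V n], and the induction hypothesis moves up one step at the coarser level. For even
    k the claim is the definition of the next set. *)
Lemma dyadic_mul n k g v : dyadic n k g -> V n v -> dyadic n k.+1 (g * v)%g.
Proof.
elim: n k g v => [|n IH] k g v /=.
  by case: k => [|[|k]]//; exact: mulsetP.
rewrite uphalf_half.
case: (odd k) => /= Bg Vv; last exact: mulsetP.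
case: Bg => w Vw Bw; rewrite add1n.
have -> : (g * v = (g * w^-1) * (w * v))%g by rewrite mulgA -(mulgA g) mulVg mulg1.
by apply: IH => //; exact: VV.
Qed.

Lemma dyadicS n k : dyadic n k `<=` dyadic n k.+1.
Proof. by move=> g Bg; rewrite -(mulg1 g); exact: dyadic_mul. Qed.

Lemma dyadic_scale n j k : dyadic (n + j) (k * 2 ^ j) = dyadic n k.
Proof.
elim: j => [|j IH]; first by rewrite addn0 expn0 muln1.
rewrite addnS /= expnS mulnCA mul2n odd_double doubleK; exact: IH.
Qed.

(** [k'] is k / 2^j rounded up, obtained by j successive halvings, each rounded up; the strict
    inequality records that less than one step of level n is lost. *)
Lemma dyadic_coarsen n j k : exists2 k', (k' * 2 ^ j < k + 2 ^ j)%N &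
  dyadic (n + j) k `<=` dyadic n k'.
Proof.
elim: j k => [|j IH] k.
  by exists k; rewrite ?addn0// expn0 muln1 addn1.
have [k' k'P sub] := IH (uphalf k); exists k'.
  rewrite expnS; move: k'P; rewrite uphalf_half => k'P.
  have := odd_double_half k; move: k'P; rewrite -muln2 -!(mulnC 2).
  by case: (odd k) => /=; lia.
rewrite addnS /= => g; have := sub g; rewrite uphalf_half.
case: (odd k) => /= sg; rewrite ?add0n//.
move=> [v Vv Bv]; apply: sg; rewrite add1n.
have -> : (g = (g * v^-1) * v)%g by rewrite -mulgA mulVg mulg1.
apply: dyadic_mul => //.
have := VV Vv (V1 _); rewrite mulg1.
by [].
Qed.

Lemma dyadic_level (R : realType) m n k : exists k',
  k'%:R / 2 ^+ n <= k%:R / 2 ^+ m + (2 ^+ n)^-1 :> R /\ dyadic m k `<=` dyadic n k'.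
Proof.
have p0 (i : nat) : 0 < 2 ^+ i :> R by rewrite exprn_gt0.
have [mn|/ltnW nm] := leqP m n.
  exists (k * 2 ^ (n - m))%N.
  have := dyadic_scale m (n - m) k; rewrite subnKC// => ->; split=> //.
  suff -> : (k * 2 ^ (n - m))%:R / 2 ^+ n = k%:R / 2 ^+ m :> R.
    by rewrite lerDl invr_ge0 ltW.
  rewrite natrM natrX -{2}(subnK mn) exprD invfM -mulrA mulVKf ?gt_eqF//.
have [k' k'P sub] := dyadic_coarsen n (m - n) k.
exists k'; rewrite subnKC// in sub; split=> //.
have E : 2 ^+ m = 2 ^+ n * 2 ^+ (m - n) :> R by rewrite -exprD subnKC.
rewrite -(ler_pM2r (p0 m)) mulrDl [k%:R / _ * _]divfK ?gt_eqF// E.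
rewrite mulrA divfK ?gt_eqF// mulKf ?gt_eqF//.
by rewrite -natrX -natrM -natrD ler_nat ltnW.
Qed.

End dyadic_chain.

Section category_function.
Context (R : realType) (G : topologicalGroupType) (rho : G -> G -> R) (q : nat -> G).
Hypothesis H : polish_metric rho q.
Hypothesis oE : @open G = metric_open rho.
Context d (Y : measurableType d) (b : G -> Y -> Y).
Hypothesis mb : borel_action b.
Hypothesis b1 : forall y, b 1%g y = y.
Hypothesis bM : forall g h y, b g (b h y) = b (g * h)%g y.
Context (V : nat -> set G).
Hypothesis oV : forall n, open (V n).
Hypothesis V1 : forall n, V n 1%g.
Hypothesis VV : forall n x y, V n.+1 x -> V n.+1 y -> V n (x * y)%g.
Variable O : set G.
Hypothesis oO : open O.
Variable S : set Y.
Hypothesis mS : measurable S.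

Let heights (y : Y) : set R := [set r | r = 1 \/
  exists n k, r = k%:R / 2 ^+ n /\ vaught b S (dyadic V O n k) y].

Definition category_fun (y : Y) : R := inf (heights y).

Let heights0 y : lbound (heights y) 0.
Proof. by move=> r [->//|[n [k [-> _]]]]; rewrite divr_ge0. Qed.

Let has_inf_heights y : has_inf (heights y).
Proof. by split; [exists 1; left|exists 0; exact: heights0]. Qed.

Lemma category_fun_ge0 y : 0 <= category_fun y.
Proof. by apply: lb_le_inf; [exists 1; left|exact: heights0]. Qed.

Lemma category_fun_le1 y : category_fun y <= 1.
Proof. by apply: ge_inf; [exists 0; exact: heights0|left]. Qed.

Lemma measurable_category_fun : measurable_fun setT category_fun.
Proof.
apply: measurable_fun_sublevel => r.
rewrite (_ : [set _ | _] = [set _ | 1 < r] `|` \bigcup_n \bigcup_k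
   (if (k%:R / 2 ^+ n : R) < r then vaught b S (dyadic V O n k) else set0)).
  apply: measurableU.
    have [r1|r1] := boolP (1 < r).
      by rewrite (_ : [set _ | _] = setT)//; apply/seteqP; split.
    by rewrite (_ : [set _ | _] = set0)//; apply/seteqP; split=> // y /= /(negP r1).
  apply: bigcupT_measurable => n; apply: bigcupT_measurable => k.
  by case: ifP => // _; apply: (measurable_vaught H oE mb mS); exact: dyadic_open.
apply/seteqP; split=> y /=.
  move=> /(inf_lt (has_inf_heights y).1)[x [->|[n [k [-> vy]]]] xr]; first by left.
  by right; exists n => //; exists k => //; rewrite xr.
move=> [r1|[n _ [k _]]]; first exact: le_lt_trans (category_fun_le1 y) r1.
case: ifP => // xr vy; apply: le_lt_trans xr; apply: ge_inf.
  by exists 0; exact: heights0.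
by right; exists n, k.
Qed.

(** Of the two steps 1/2^n, one is lost in rounding a height up to level n, the other in the
    translation by an element of [V n]. *)
Let category_fun_shift n g y : V n (g^-1)%g ->
  category_fun (b g y) <= category_fun y + 2 / 2 ^+ n.
Proof.
move=> Vg; rewrite -lerBlDr; apply: lb_le_inf; first by exists 1; left.
move=> r [->|[m [k [-> vy]]]]; rewrite lerBlDr.
  by apply: le_trans (category_fun_le1 _) _; rewrite lerDl divr_ge0.
have [k' [k'P sub]] := dyadic_level V1 VV O R m n k.
apply: (@le_trans _ _ (k'.+1%:R / 2 ^+ n)).
  apply: ge_inf; first by exists 0; exact: heights0.
  right; exists n, k'.+1; split=> //.
  apply: (vaught_shift bM _ (vaughtS sub vy)) => h Bh.
  exact: dyadic_mul.
rewrite -natr1 mulrDl mul1r.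
apply: le_trans (lerD k'P (lexx _)) _; rewrite -addrA lerD2l.
by rewrite mulr2n mulrDl !mul1r.
Qed.

Lemma category_fun_continuous n g y : V n g -> V n (g^-1)%g ->
  `|category_fun (b g y) - category_fun y| <= 2 / 2 ^+ n.
Proof.
move=> Vg Vg'; have h1 := category_fun_shift y Vg'.
have := @category_fun_shift n g^-1%g (b g y); rewrite invgK => /(_ Vg).
rewrite bM mulVg b1 => h2.
by rewrite ler_norml lerBlDl lerBrDl lerBlDr h1 h2.
Qed.

Lemma category_fun_eq0 y : vaught b S O y -> category_fun y = 0.
Proof.
move=> vy; apply/eqP; rewrite eq_le category_fun_ge0 andbT.
apply: ge_inf; first by exists 0; exact: heights0.
by right; exists 0%N, 0%N; rewrite mul0r.
Qed.

Lemma category_fun_eq1 y : ~ vaught b S (mulset O (V 0%N)) y -> category_fun y = 1.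
Proof.
move=> nvy; apply/eqP; rewrite eq_le category_fun_le1/=.
apply: lb_le_inf; first by exists 1; left.
move=> r [->//|[n [k [-> vy]]]]; rewrite ler_pdivlMr ?exprn_gt0// mul1r.
rewrite leNgt -natrX ltr_nat; apply/negP => kn; apply: nvy.
have [k' k'n] := dyadic_coarsen V1 VV O 0 n k; rewrite add0n => sub.
(* A height below 1 rounds up to 0 or 1 at level 0, where the sets are [O] and [mulset O (V 0)]. *)
have : (k' <= 1)%N by nia.
case: k' sub {k'n} => [|[|//]] sub _; apply: vaughtS vy => g /sub //.
exact: (dyadicS V1 VV (n := 0) (k := 0)).
Qed.

End category_function.

Lemma identity_neighborhood_chain (R : realType) (G : topologicalGroupType)
    (rho : G -> G -> R) (q : nat -> G) :
  polish_metric rho q -> @open G = metric_open rho ->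
  exists V : nat -> set G, [/\ forall n, open (V n), forall n, V n 1%g,
    forall n x y, V n.+1 x -> V n.+1 y -> V n (x * y)%g &
    forall n g, V n g -> rho 1%g g < n.+1%:R^-1].
Proof.
move=> H oE.
pose B n := [set g : G | rho 1%g g < n.+1%:R^-1].
have oB n : open (B n) by rewrite oE; exact: (metric_open_ball H).
have B1 n : B n 1%g by rewrite /B/= (pm_refl H) invr_gt0.
have stepE (nU : nat * set G) : exists W, open nU.2 -> nU.2 1%g ->
    [/\ open W, W 1%g, W `<=` B nU.1 & forall x y, W x -> W y -> nU.2 (x * y)%g].
  case: nU => n U /=; have [oU|noU] := pselect (open U); last by exists set0.
  have [U1|nU1] := pselect (U 1%g); last by exists set0.
  have [|W1 [W2 [oW1 W11 oW2 W21 WU]]] := @open_mulg_split _ U 1%g 1%g oU.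
    by rewrite mulg1.
  exists (W1 `&` W2 `&` B n) => _ _; split=> //.
  - by apply: openI => //; exact: openI.
  - by move=> x y [[W1x _] _] [[_ W2y] _]; exact: WU.
have [step stepP] := choice stepE.
pose V := fix V n := if n is m.+1 then step (n, V m) else B 0%N.
have VP n : open (V n) /\ V n 1%g.
  elim: n => [|n [oVn Vn1]]; first by split; [exact: oB|exact: B1].
  by have [oW W1 _ _] := stepP (n.+1, V n) oVn Vn1.
exists V; split=> [n|n|n x y|[|n] g //].
- exact: (VP n).1.
- exact: (VP n).2.
- by have [_ _ _ VV] := stepP (n.+1, V n) (VP n).1 (VP n).2; exact: VV.
- by have [_ _ VB _] := stepP (n.+1, V n) (VP n).1 (VP n).2; exact: VB.
Qed.

(** The functions are indexed by a basic open set of Y, the basic open set of G where the chain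
    starts, and the index m from which the neighbourhoods [V] are used. All three range over
    countable sets, and together they separate any two points. *)
Lemma spatial_uniform_functions (R : realType) (G : topologicalGroupType)
    d (Y : measurableType d) (b : G -> Y -> Y) :
  polish R G -> standard_borel R Y -> borel_action b ->
  (forall y, b 1%g y = y) -> (forall g h y, b g (b h y) = b (g * h)%g y) ->
  exists h : nat -> Y -> R, [/\ forall n, measurable_fun setT (h n),
    forall n y, 0 <= h n y <= 1,
    forall n e, 0 < e -> exists U, [/\ open U, U 1%g &
      forall g y, U g -> `|h n (b g y) - h n y| <= e] &
    forall y y', y <> y' -> exists n, h n y <> h n y'].
Proof.
move=> /(polish_polish_metric (1%g : G))[rho [q [H oE]]].
move=> /standard_borel_metric[rhoY [qY [HY mY]]] mb b1 bM.
have [V [oV V1 VV Vrho]] := identity_neighborhood_chain H oE.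
pose S k := metric_base rhoY qY k.
have mS k : measurable (S k).
  rewrite mY; apply: sub_sigma_algebra; rewrite /S /metric_base.
  by case: unpickle => [p|x []]; exact: (metric_open_ball HY).
(* Dropping the first m neighbourhoods makes the first enlargement of [O n] in the chain as small as
   the separation argument demands. *)
pose Vm m i := V (m + i)%N.
have oVm m i : open (Vm m i) by exact: oV.
have Vm1 m i : Vm m i 1%g by exact: V1.
have VVm m i x y : Vm m i.+1 x -> Vm m i.+1 y -> Vm m i (x * y)%g.
  by rewrite /Vm addnS; exact: VV.
pose O n := metric_base rho q n.
have oO n : open (O n) by exact: (metric_base_open H oE).
pose h (p : nat * nat * nat) := category_fun R b (Vm p.2) (O p.1.2) (S p.1.1).
pose hn i := if unpickle i is Some p then h p else cst 0.
exists hn; split.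
- move=> i; rewrite /hn; case: unpickle => [p|]; last exact: measurable_cst.
  exact: (measurable_category_fun H oE mb).
- move=> i y; rewrite /hn; case: unpickle => [p|]; last by rewrite /cst lexx ler01.
  by rewrite /h category_fun_ge0 category_fun_le1.
- move=> i e e0; rewrite /hn; case: unpickle => [[[k n] m]|]; last first.
    by exists setT; split=> // [|g y _]; [exact: openT|rewrite subrr normr0 ltW].
  have [j je] : exists j, 2 / 2 ^+ j <= e.
    have [j je] := invn_lt (divr_gt0 e0 (ltr0n _ 2)).
    exists j; rewrite mulrC -ler_pdivlMr//; apply: le_trans (ltW je).
    rewrite lef_pV2 ?posrE ?exprn_gt0// -natrX ler_nat.
    exact: ltn_expl.
  exists (Vm m j `&` [set g | Vm m j (g^-1)%g]); split.
  + by apply: openI => //; exact: open_invg.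
  + by split=> //=; rewrite invg1.
  + move=> g y [Vg Vg']; apply: le_trans je.
    exact: (category_fun_continuous R b1 bM (Vm1 m) (VVm m)).
- move=> y y' yy'.
  have moved g : b g y <> b g y'.
    move=> /(congr1 (b g^-1%g)); rewrite !bM mulVg !b1; exact: yy'.
  pose E k := [set g | S k (b g y)] `\` [set g | S k (b g y')].
  have dE k : locally_decided (E k).
    have dy z := locally_decided_orbit H oE mb z (mS k).
    have -> : E k = ~` (\bigcup_i (if i is 0%N then ~` [set g | S k (b g y)]
                         else [set g | S k (b g y')])).
      apply/seteqP; split=> g.
        by move=> [Sy nSy'] [[|i] _].
      move=> nU; split; first by apply: contrapT => nS; apply: nU; exists 0%N.
      by move=> Sy'; apply: nU; exists 1%N.
    apply: locally_decided_setC; apply: (locally_decided_bigcup H oE).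
    by case=> [|i]; [apply: locally_decided_setC; exact: dy|exact: dy].
  (* The sets [E k] cover G: for every g the points [b g y] and [b g y'] differ, so some basic open
     set contains the first and not the second. By Baire category one of the [E k] is nonmeager. *)
  have [k nE] : exists k, ~ meager (setT `&` E k).
    apply: contrapT => /forallNP mE.
    apply: (open_nonmeager H oE openT); first by exists 1%g.
    apply: (@meagerS _ (\bigcup_k (setT `&` E k))); last first.
      by apply: meager_bigcup => k; exact: contrapT.
    move=> g _; have e0 : 0 < rhoY (b g y) (b g y').
      rewrite lt_neqAle eq_sym; apply/andP; split.
        by apply/eqP => /(pm_eq0 HY); exact: moved.
      have := pm_tri HY (b g y') (b g y) (b g y).
      by rewrite (pm_refl HY) (pm_sym HY (b g y')) -mulr2n pmulrn_lge0.
    have oB : metric_open rhoY [set z | rhoY (b g y) z < rhoY (b g y) (b g y')].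
      exact: (metric_open_ball HY).
    have [|i [j [xi iB]]] := metric_open_base HY (x := b g y) oB.
      by rewrite /= (pm_refl HY).
    exists (pickle (i, j)) => //; split=> //; rewrite /E /S /metric_base pickleK /=.
    split=> /=; rewrite (pm_sym HY)// => /iB /=.
    by rewrite ltxx.
  have [W [oW [g Wg] _ mW]] := nonmeager_comeager H oE openT (dE k) nE.
  have [|A [B [oA Ag oB B1 ABW]]] := @open_mulg_split _ W g 1%g oW.
    by rewrite mulg1.
  have [n [ng nA]] := metric_baseP H oE oA Ag.
  have [m mB] : exists m, V m `<=` B.
    move: oB; rewrite oE => /(_ _ B1)[e e0 eB].
    have [m me] := invn_lt e0; exists m => x /Vrho xm; apply: eB.
    exact: lt_trans me.
  have AW : mulset (O n) (Vm m 0%N) `<=` W.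
    move=> x [v Vv Ox]; rewrite -(mulg1 x) -(mulVg v) mulgA; apply: ABW.
      exact: nA.
    by apply: mB; rewrite /Vm addn0 in Vv.
  (* [E k] is comeager in [W], which contains the product of [O n] and [V m]. Hence [S k] holds
     along the orbit of y nonmeagerly in [O n], giving the value 0, and along the orbit of y' only
     meagerly in that product, giving the value 1. *)
  exists (pickle (k, n, m)); rewrite /hn pickleK /h /=.
  rewrite category_fun_eq0; last first.
    move=> mOE; apply: (open_nonmeager H oE (oO n)); first by exists g.
    apply: meagerS (meagerU mOE mW) => x Ox.
    have [Ex|nEx] := pselect (E k x); first by left; case: Ex.
    right; split=> //; apply: AW; rewrite -(mulg1 x); apply: mulsetP => //.
  rewrite (category_fun_eq1 R (Vm1 m) (VVm m)).

    by move=> /esym/eqP; rewrite oner_eq0.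
  move=> nm; apply: nm; apply: meagerS mW => x [/AW Wx Sx].
  by split=> // -[_].
Qed.

(** * Essential bounds and G-continuity *)

Lemma Lnorm_oo_le (R : realType) d (X : measurableType d) (mu : probability X R)
    (f : X -> R) (e : R) :
  (Lnorm mu +oo (EFin \o f) <= e%:E)%E <-> \forall x \ae mu, `|f x| <= e.
Proof.
have mu1 : (0 < mu [set: X])%E by rewrite probability_setT lte01.
rewrite unlock /Lnorm ifT; last exact: mu1.
split.
  by move=> /ess_supP; apply: filterS => x /=; rewrite lee_fin.
by move=> fe; apply/ess_supP; apply: filterS fe => x /=; rewrite lee_fin.
Qed.

Lemma G_continuous_measurable (R : realType) (G : topologicalGroupType) d
    (X : measurableType d) (mu : probability X R) (a : G -> X -> X) (f : X -> R) :
  G_continuous mu a f -> measurable_fun setT f.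
Proof. by move=> [/sub_Lfun_mfun]; rewrite inE. Qed.

Lemma uniform_G_continuous (R : realType) (G : topologicalGroupType) d
    (X : measurableType d) (mu : probability X R) (a : G -> X -> X) (f : X -> R) :
  measurable_fun setT f -> (forall x, 0 <= f x <= 1) ->
  (forall e, 0 < e -> exists U, [/\ open U, U 1%g &
    forall g, U g -> \forall x \ae mu, `|f (a g x) - f x| <= e]) ->
  G_continuous mu a f.
Proof.
move=> mf f01 fU; split.
  apply/andP; split; first by rewrite inE.
  rewrite inE /finLfun /=.
  rewrite /finite_norm; apply: (@le_lt_trans _ _ 1%:E); last exact: ltry.
  apply/Lnorm_oo_le; apply: aeW => x; have /andP[f0 f1] := f01 x.
  by rewrite ger0_norm.
move=> u u1; apply/fine_cvgP; split.
  have [U [oU U1 UP]] := fU 1 ltr01.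
  have : \forall n \near \oo, U (u n) by apply: u1; exact: open_nbhs_nbhs.
  apply: filterS => n /UP/Lnorm_oo_le le1.
  rewrite fin_numElt (lt_le_trans _ (Lnorm_ge0 _ _ _))//=.
  exact: le_lt_trans le1 (ltry _).
apply/cvgrPdist_le => e e0; have [U [oU U1 UP]] := fU e e0.
have : \forall n \near \oo, U (u n) by apply: u1; exact: open_nbhs_nbhs.
apply: filterS => n /UP/Lnorm_oo_le le1 /=.
rewrite sub0r normrN ger0_norm; last by rewrite fine_ge0// Lnorm_ge0.
rewrite -lee_fin fineK// fin_numElt (lt_le_trans _ (Lnorm_ge0 _ _ _))//=.
exact: le_lt_trans le1 (ltry _).
Qed.

(** Metrizability of G turns the sequential condition into one on neighbourhoods: otherwise a bad g
    could be picked in each ball of radius 1/(n+1) around the identity, and these would converge to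
    it. *)
Lemma G_continuous_uniform (R : realType) (G : topologicalGroupType) d
    (X : measurableType d) (mu : probability X R) (a : G -> X -> X) (f : X -> R)
    (e : R) :
  polish R G -> G_continuous mu a f -> 0 < e ->
  exists U, [/\ open U, U 1%g &
    forall g, U g -> \forall x \ae mu, `|f (a g x) - f x| <= e].
Proof.
move=> /(polish_polish_metric (1%g : G))[rho [q [H oE]]] [_ fc] e0.
apply: contrapT => nex.
have ex n : exists g, rho 1%g g < n.+1%:R^-1 /\
    ~ \forall x \ae mu, `|f (a g x) - f x| <= e.
  apply: contrapT => nexn; apply: nex.
  exists [set g | rho 1%g g < n.+1%:R^-1]; split.
  - by rewrite oE; exact: (metric_open_ball H).
  - by rewrite /= (pm_refl H) invr_gt0.
  - by move=> g gn; apply: contrapT => nle; apply: nexn; exists g.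
have [u uP] := choice ex.
have u1 : u @ \oo --> (1%g : G).
  move=> A; rewrite nbhsE => -[B [oB B1] BA].
  move: oB; rewrite oE => /(_ _ B1)[r r0 rB].
  have [n nr] := invn_lt r0; exists n => //= m /= nm; apply/BA/rB.
  apply: lt_trans (uP m).1 _; apply: le_lt_trans nr.
  by rewrite lef_pV2 ?posrE// ler_nat.
have nb : nbhs (0 : \bar R)%E [set y | (y < e%:E)%E].
  by apply: open_nbhs_nbhs; split; [exact: open_ereal_lt_ereal|rewrite /= lte_fin].
have [n _ /(_ n (leqnn n))/= /ltW] := fc u u1 _ nb.
by move=> /Lnorm_oo_le; exact: (uP n).2.
Qed.

Lemma spatial_model_separating_functions (R : realType)
    (G : topologicalGroupType) d (X : measurableType d) (mu : probability X R)
    (a : G -> X -> X) :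
  polish R G -> has_spatial_model mu a ->
  exists f : nat -> X -> R,
    (forall n, G_continuous mu a (f n)) /\ separates_points_mod0 mu f.
Proof.
move=> pG [d' [Y [nu [b [sY [mb b1 bM _] [phi [[mphi _] [psi [_ psiphi _]] phib]]]]]]].
have [h [mh h01 hU hsep]] := spatial_uniform_functions pG sY mb b1 bM.
exists (fun n => h n \o phi); split.
  move=> n; apply: uniform_G_continuous.
  - exact: measurableT_comp.
  - by move=> x; exact: h01.
  - move=> e e0; have [U [oU U1 UP]] := hU n e e0.
    exists U; split=> // g Ug; apply: filterS (phib g) => x /= ->.
    exact: UP.
case: psiphi => N [mN N0 sN].
exists (~` N); split; first exact: measurableC.
  by rewrite probability_setC// N0 sube0.
have NP x : (~` N) x -> psi (phi x) = x.
  by move=> Nx; apply: contrapT => ne; apply: Nx; exact: sN.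
move=> x x' /NP psix /NP psix' xx'.
have [|n hn] := hsep (phi x) (phi x'); last by exists n.
by move=> e; apply: xx'; rewrite -psix -psix' e.
Qed.

(** * Function spaces as spatial models *)

Section coordinate_metric.
Context (R : realType) d (Y : measurableType d) (c : nat -> Y -> R).
Hypothesis c_inj : forall y y', (forall k, c k y = c k y') -> y = y'.
Hypothesis c_closed : forall (u : nat -> Y) (v : nat -> R),
  (forall k (e : R), 0 < e ->
    exists N, forall n, (N <= n)%N -> `|c k (u n) - v k| <= e) ->
  exists l, forall k, c k l = v k.

Let gap k y y' := Num.min `|c k y - c k y'| k.+1%:R^-1.

(** Capping the k-th difference at 1/(k+1) leaves finitely many coordinates relevant at each scale,
    so this induces the topology of pointwise convergence of the coordinates; [c_closed] says that
    their image is sequentially closed in the space of real sequences. *)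
Definition coord_dist (y y' : Y) : R := sup (range (fun k => gap k y y')).

Let gap_ge0 k y y' : 0 <= gap k y y'.
Proof. by rewrite le_min normr_ge0 invr_ge0 ler0n. Qed.

Let gap_le k y y' : gap k y y' <= k.+1%:R^-1.
Proof. by rewrite ge_min lexx orbT. Qed.

Let coord_distP y y' r : coord_dist y y' <= r <-> forall k, gap k y y' <= r.
Proof.
split=> [dr k|gr].
  apply: le_trans dr; apply: ub_le_sup; last by exists k.
  exists 1 => _ [j _ <-]; apply: le_trans (gap_le _ _ _) _.
  by rewrite invf_le1// ler1n.
apply: ge_sup; first by exists (gap 0 y y'); exists 0%N.
by move=> _ [j _ <-].
Qed.

Let gap_le_dist k y y' : gap k y y' <= coord_dist y y'.
Proof. by have /coord_distP := lexx (coord_dist y y'); exact. Qed.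

Let gap_tri k y x z : gap k x z <= gap k x y + gap k y z.
Proof.
rewrite [gap k x y]/gap; have [xy|xy] := leP `|c k x - c k y| k.+1%:R^-1; last first.
  by apply: le_trans (gap_le _ _ _) _; rewrite lerDl.
rewrite [gap k y z]/gap; have [yz|yz] := leP `|c k y - c k z| k.+1%:R^-1; last first.
  by apply: le_trans (gap_le _ _ _) _; rewrite lerDr.
by rewrite ge_min (ler_distD (c k y)).
Qed.

Let gap_sym k y y' : gap k y y' = gap k y' y.
Proof. by rewrite /gap distrC. Qed.

Let dist_sym y y' : coord_dist y y' = coord_dist y' y.
Proof.
apply/eqP; rewrite eq_le; apply/andP; split; apply/coord_distP => k;
  by rewrite gap_sym.
Qed.

Let dist_tri y x z : coord_dist x z <= coord_dist x y + coord_dist y z.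
Proof.
apply/coord_distP => k; apply: le_trans (gap_tri k y x z) _.
exact: lerD.
Qed.

Let gap_lt k y y' r : gap k y y' <= r -> r < k.+1%:R^-1 -> `|c k y - c k y'| <= r.
Proof. by rewrite ge_min => /orP[//|kr rk]; have := lt_le_trans rk kr; rewrite ltxx. Qed.

Let dist_eq0 y y' : coord_dist y y' = 0 -> y = y'.
Proof.
move=> d0; apply: c_inj => k; apply/eqP; rewrite -subr_eq0 -normr_le0.
apply: gap_lt; last by rewrite invr_gt0.
by rewrite -d0.
Qed.

(** For each finite list of rationals one point of Y with nearby first coordinates is chosen, if
    there is any, and [point] otherwise. The length of the list sets both the number of coordinates
    and the precision. *)
Let dist_dense : exists q : nat -> Y, forall y e, 0 < e -> exists i, coord_dist y (q i) < e.
Proof.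
pose near (s : seq rat) y := forall k, (k < size s)%N ->
  `|c k y - ratr s`_k| < (size s).+1%:R^-1.
have qs s : exists y, (exists z, near s z) -> near s y.
  by have [[z sz]|ns] := pselect (exists z, near s z); [exists z|exists point].
have [q qP] := choice qs.
exists (fun i => q (odflt [::] (unpickle i))) => y e e0.
have [n ne] := invn_lt (divr_gt0 e0 (ltr0n _ 2)).
have i0 : 0 < n.+1%:R^-1 :> R by rewrite invr_gt0.
have ratE k : exists r : rat, `|c k y - ratr r| < n.+1%:R^-1.
  have [|r] := @rat_in_itvoo R (c k y - n.+1%:R^-1) (c k y + n.+1%:R^-1).
    by rewrite ltrBlDr -addrA ltrDl addr_gt0.
  rewrite in_itv/= => /andP[r1 r2]; exists r.
  by rewrite distrC ltr_distl r1 r2.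
have [r rP] := choice ratE.
pose s := mkseq r n; exists (pickle s); rewrite pickleK /=.
have sy : near s y by move=> k; rewrite size_mkseq => kn; rewrite nth_mkseq.
have sq := qP s (ex_intro _ y sy).
apply: (@le_lt_trans _ _ (n.+1%:R^-1 + n.+1%:R^-1)); last first.
  by rewrite [e]splitr; apply: ltrD.
apply/coord_distP => k; have [kn|nk] := ltnP k n.
  rewrite ge_min; apply/orP; left.
  move: sq => /(_ k); rewrite size_mkseq => /(_ kn); rewrite nth_mkseq// => kq.
  apply: le_trans (ler_distD (ratr (r k)) _ _) _; rewrite lerD// ltW//.
  by rewrite distrC.
apply: le_trans (gap_le _ _ _) _; rewrite -[X in X <= _]addr0; apply: lerD; last exact: ltW.
by rewrite lef_pV2 ?posrE// ler_nat ltnS.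
Qed.

Let dist_complete (u : nat -> Y) :
  (forall m n, coord_dist (u m) (u n) <= m.+1%:R^-1 + n.+1%:R^-1) ->
  exists l, forall n, coord_dist (u n) l <= n.+1%:R^-1.
Proof.
move=> uc.
have cu k : cvg (c k (u n) @[n --> \oo]).
  apply: cauchy_cvg; apply: cauchy_exP => e e0.
  (* Below the cap 1/(k+1) the gap is the true difference of the k-th coordinates. *)
  pose m := Num.min (e / 2) k.+1%:R^-1.
  have [N Nm] : exists N : nat, N.+1%:R^-1 < m / 2.
    by apply: invn_lt; rewrite divr_gt0// lt_min divr_gt0//= invr_gt0.
  exists (c k (u N)); exists N => // n /= Nn.
  have b : N.+1%:R^-1 + n.+1%:R^-1 < m.
    rewrite [m]splitr ltrD//; apply: le_lt_trans Nm.
    by rewrite lef_pV2 ?posrE// ler_nat.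
  apply: (@le_lt_trans _ _ (N.+1%:R^-1 + n.+1%:R^-1)).
    apply: gap_lt; first exact: le_trans (gap_le_dist _ _ _) (uc _ _).
    by apply: lt_le_trans b _; rewrite ge_min lexx orbT.
  apply: lt_trans b _; apply: (@le_lt_trans _ _ (e / 2)).
    by rewrite ge_min lexx.
  by rewrite ltr_pdivrMr// mulr_natr mulr2n ltrDl.
pose v k := limn (fun n => c k (u n)).
have vP k e : 0 < e -> exists N, forall n, (N <= n)%N -> `|c k (u n) - v k| <= e.
  move=> e0; have [N _ NP] := (@cvgrPdist_le _ _ _ _ _ _ _).1 (cu k) e e0.
  by exists N => n Nn; rewrite distrC; exact: NP.
have [l lv] := c_closed vP.
exists l => n; apply/coord_distP => k; apply/ler_addgt0Pl => e e0.
have e20 : 0 < e / 2 by rewrite divr_gt0.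
have [N NP] := vP k _ e20; have [j je] := invn_lt e20.
pose p := maxn N j.
apply: le_trans (gap_tri k (u p) _ _) _.
have g1 : gap k (u n) (u p) <= n.+1%:R^-1 + e / 2.
  apply: le_trans (gap_le_dist _ _ _) _; apply: le_trans (uc _ _) _.
  rewrite lerD2l; apply: ltW; apply: le_lt_trans je.
  by rewrite lef_pV2 ?posrE// ler_nat ltnS leq_maxr.
have g2 : gap k (u p) l <= e / 2.
  by rewrite ge_min lv NP// leq_maxl.
by apply: le_trans (lerD g1 g2) _; rewrite -addrA -splitr addrC.
Qed.

Lemma coord_standard_borel :
  @measurable d Y = <<s \bigcup_k preimage_set_system [set: Y] (c k) measurable >> ->
  standard_borel R Y.
Proof.
move=> mY; have [q qd] := dist_dense.
have H : polish_metric coord_dist q.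
  split; [|exact: dist_eq0|exact: dist_sym|exact: dist_tri|exact: qd|exact: dist_complete].
  move=> y; apply/eqP; rewrite eq_le; apply/andP; split.
    by apply/coord_distP => k; rewrite /gap subrr normr0 ge_min lexx.
  exact: le_trans (gap_ge0 0 _ _) (gap_le_dist _ _ _).
have mc k : measurable_fun setT (c k).
  move=> _ B mB; rewrite mY; apply: sub_sigma_algebra; exists k => //.
  by exists B.
apply: (metric_standard_borel H); apply/seteqP; split.
  rewrite mY; apply: smallest_sub; first exact: smallest_sigma_algebra.
  move=> _ [k _ [B mB <-]].
  have : preimage_set_system setT (c k) measurable ([set: Y] `&` c k @^-1` B) by exists B.
  have -> : (measurable : set_system R) = <<s @RGenInftyO.G R >>.
    exact: RGenInftyO.measurableE.
  rewrite preimage_sigma_algebra; move: ([set: Y] `&` c k @^-1` B); apply: sub_sigma_algebra2.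
  move=> _ [_ [x ->] <-]; rewrite setTI => y /=; rewrite in_itv/= => yx.
  exists (Num.min (x - c k y) k.+1%:R^-1).
    by rewrite lt_min subr_gt0 yx invr_gt0 ltr0n.
  move=> z yz; rewrite /= in_itv/=.
  have : `|c k y - c k z| <= coord_dist y z.
    by apply: gap_lt (gap_le_dist k y z) _; apply: lt_le_trans yz _; rewrite ge_min lexx orbT.
  move: yz; rewrite lt_min => /andP[yz _] zy.
  have := le_lt_trans zy yz; rewrite distrC ltr_norml => /andP[_].
  by rewrite ltrD2r.
apply: smallest_sub; first exact: sigma_algebra_measurable.
move=> A oA.
have mcball z r : measurable [set y | coord_dist y z <= r].
  rewrite (_ : [set _ | _] = \bigcap_k [set y | gap k y z <= r]).
    apply: bigcapT_measurable => k.
    have mg : measurable_fun setT (fun y => gap k y z).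
      apply: measurable_minr; last exact: measurable_cst.
      apply: measurableT_comp => //; apply: measurable_funB => //; exact: measurable_cst.
    rewrite (_ : [set _ | _] = (fun y => gap k y z) @^-1` [set` `]-oo, r]]).
      by rewrite -[X in measurable X]setTI; exact: mg.
    by apply/seteqP; split=> y /=; rewrite in_itv.
  apply/seteqP; split=> y /=; first by move=> /coord_distP yz k _; exact: yz.
  by move=> yz; apply/coord_distP => k; exact: yz.
have mball z r : measurable [set y | coord_dist y z < r].
  rewrite (_ : [set _ | _] = \bigcup_j [set y | coord_dist y z <= r - j.+1%:R^-1]).
    exact: bigcupT_measurable.
  apply/seteqP; split=> y /=.
    rewrite -subr_gt0 => /invn_lt[j /ltW jr]; exists j => //=.
    by rewrite lerBrDr addrC -lerBrDr.
  by move=> [j _ /=]; move/le_lt_trans; apply; rewrite ltrBlDr ltrDl invr_gt0.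
rewrite (_ : A = \bigcup_i \bigcup_k
    (if `[< [set y | coord_dist y (q i) < k.+1%:R^-1] `<=` A >]
    then [set y | coord_dist y (q i) < k.+1%:R^-1] else set0)).
  apply: bigcupT_measurable => i; apply: bigcupT_measurable => k.
  by case: ifP => // _; exact: mball.
apply/seteqP; split=> y.
  move=> Ay; have [i [k [yi iA]]] := metric_open_base H oA Ay.
  by exists i => //; exists k => //; rewrite asboolT.
by move=> [i _ [k _]]; case: asboolP => // + yi; exact.
Qed.

End coordinate_metric.

(** * The space of equicontinuous sequences of functions on G *)

Lemma eq_of_dist_le (R : realType) (x y : R) :
  (forall e, 0 < e -> `|x - y| <= e) -> x = y.
Proof.
move=> xy; apply/eqP; rewrite -subr_eq0 -normr_le0.
by apply/ler_addgt0Pl => e e0; rewrite addr0; exact: xy.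
Qed.

(* [U n m] prescribes a modulus of equicontinuity for the n-th component;
   this class of functions is invariant under right translations. *)
Definition equicontinuous_for (R : realType) (G : topologicalGroupType)
    (U : nat -> nat -> set G) (F : nat -> G -> R) : Prop :=
  forall n m g g', U n m (g' * g^-1)%g -> `|F n g' - F n g| <= m.+1%:R^-1.

Record equifun (R : realType) (G : topologicalGroupType)
    (U : nat -> nat -> set G) : Type := EquiFun {
  equifun_val :> nat -> G -> R ;
  equifun_equicontinuous : equicontinuous_for U equifun_val
}.

HB.instance Definition _ R G U := gen_eqMixin (@equifun R G U).
HB.instance Definition _ R G U := gen_choiceMixin (@equifun R G U).

Lemma equicontinuous_for0 R G U :
  @equicontinuous_for R G U (fun _ _ => 0).
Proof. by move=> n m g g' _; rewrite subrr normr0 invr_ge0. Qed.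

HB.instance Definition _ R G U :=
  isPointed.Build (@equifun R G U) (EquiFun (@equicontinuous_for0 R G U)).

Section equifun_space.
Context (R : realType) (G : topologicalGroupType) (rho : G -> G -> R) (q : nat -> G).
Hypothesis H : polish_metric rho q.
Hypothesis oE : @open G = metric_open rho.
Variable U : nat -> nat -> set G.
Hypothesis oU : forall n m, open (U n m).
Hypothesis U1 : forall n m, U n m 1%g.
Implicit Types F : equifun R U.

Lemma equifun_eq F F' : (forall n g, F n g = F' n g) -> F = F'.
Proof.
case: F F' => [F PF] [F' PF'] /= FF; have {}FF : F = F'.
  by apply/funext => n; apply/funext => g.
by case: _ / FF PF' => PF'; congr EquiFun; exact: Prop_irrelevance.
Qed.

Lemma dense_meets A g : open A -> A g -> exists j, A (q j).
Proof.
rewrite oE => oA Ag; have [e e0 eA] := oA g Ag.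
by have [j gj] := pm_dense H g e0; exists j; exact: eA.
Qed.

Lemma dense_approx_ex (g : G) i : exists j, rho g (q j) < i.+1%:R^-1.
Proof. by apply: (pm_dense H); rewrite invr_gt0. Qed.

(** Points near g have quotients in [U n m], so [w n] is Cauchy along every part of the dense
    sequence converging to g. The moduli survive in the limit because [U n m] is open: if g' * g^-1
    belongs to it, so do the quotients of nearby points of the sequence. *)
Lemma equicontinuous_extension (w : nat -> nat -> R) :
  (forall n m j j', U n m (q j' * (q j)^-1)%g -> `|w n j' - w n j| <= m.+1%:R^-1) ->
  exists F, forall n j, F n (q j) = w n j.
Proof.
move=> wU.
have near_g n m g : exists A, [/\ open A, A g &
    forall x y, A x -> A y -> U n m (x * y^-1)%g].
  have [|A [B [oA Ag oB Bg AB]]] := @open_mulg_split _ (U n m) g g^-1%g (oU n m).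
    by rewrite mulgV.
  exists (A `&` [set x | B (x^-1)%g]); split=> //.
    by apply: openI => //; exact: open_invg.
  by move=> x y [Ax _] [_ By]; exact: AB.
have limP n g : exists l : R, forall m, exists A, [/\ open A, A g &
    forall j, A (q j) -> `|w n j - l| <= m.+1%:R^-1].
  have [j jP] := choice (dense_approx_ex g).
  have jA A : open A -> A g -> exists N, forall i, (N <= i)%N -> A (q (j i)).
    rewrite oE => oA Ag; have [e e0 eA] := oA g Ag; have [N Ne] := invn_lt e0.
    exists N => i Ni; apply: eA; apply: lt_trans (jP i) _; apply: le_lt_trans Ne.
    by rewrite lef_pV2 ?posrE// ler_nat.
  have cw : cvg (w n (j i) @[i --> \oo]).
    apply: cauchy_cvg; apply: cauchy_exP => e e0; have [m me] := invn_lt e0.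
    have [A [oA Ag AU]] := near_g n m g; have [N NA] := jA A oA Ag.
    exists (w n (j N)); exists N => // i /= Ni.
    apply: le_lt_trans me; apply: wU; apply: AU; exact: NA.
  exists (limn (fun i => w n (j i))) => m.
  have [A [oA Ag AU]] := near_g n m g; exists A; split=> // k Ak.
  apply/ler_addgt0Pl => e e0.
  have [N1 _ NP] := (@cvgrPdist_le _ _ _ _ _ _ _).1 cw e e0.
  have [N2 NA] := jA A oA Ag.
  pose i := maxn N1 N2.
  apply: le_trans (ler_distD (w n (j i)) _ _) _; rewrite addrC; apply: lerD.
    by rewrite distrC; apply: NP; rewrite /= leq_maxl.
  by apply: wU; apply: AU => //; apply: NA; rewrite leq_maxr.
have [F FP] := choice (fun ng => limP ng.1 ng.2).
have Fw n j : F (n, q j) = w n j.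
  apply: eq_of_dist_le => e e0; have [m me] := invn_lt e0.
  have [A [_ Aj AP]] := FP (n, q j) m.
  by rewrite distrC; apply: le_trans (ltW me); exact: AP.
suff PF : equicontinuous_for U (fun n g => F (n, g)).
  by exists (EquiFun PF) => n j; exact: Fw.
move=> n m g g' Ugg'; apply/ler_addgt0Pl => e e0.
have [k ke] := invn_lt (divr_gt0 e0 (ltr0n _ 2)).
have [A [oA Ag AP]] := FP (n, g) k; have [A' [oA' Ag' AP']] := FP (n, g') k.
have [B' [B [oB' Bg' oB Bg BU]]] := open_mulg_split (oU n m) Ugg'.
have [j [Aj Bj]] : exists j, (A `&` [set x | B (x^-1)%g]) (q j).
  by apply: (@dense_meets _ g) => //; apply: openI => //; exact: open_invg.
have [j' [Aj' Bj']] : exists j, (A' `&` B') (q j).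
  by apply: (@dense_meets _ g') => //; exact: openI.
apply: le_trans (ler_distD (w n j') _ _) _.
apply: le_trans (lerD (lexx _) (ler_distD (w n j) _ _)) _.
have h1 : `|F (n, g') - w n j'| <= e / 2.
  by rewrite distrC; apply: le_trans (AP' _ Aj') (ltW ke).
have h2 : `|w n j - F (n, g)| <= e / 2 by apply: le_trans (AP _ Aj) (ltW ke).
have h3 : `|w n j' - w n j| <= m.+1%:R^-1 by apply: wU; exact: BU.
rewrite [leRHS]addrC addrCA; apply: lerD => //.
by rewrite [leRHS]splitr; exact: lerD.
Qed.

Lemma equifun_continuous F n g (e : R) : 0 < e ->
  exists A, [/\ open A, A g & forall x, A x -> `|F n x - F n g| <= e].
Proof.
move=> e0; have [m me] := invn_lt e0.
exists [set x | U n m (x * g^-1)%g]; split.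
- exact: open_mulgr.
- by rewrite /= mulgV.
- by move=> x Ux; apply: le_trans (ltW me); exact: (equifun_equicontinuous F).
Qed.

Lemma equifun_dense_eq F F' : (forall n j, F n (q j) = F' n (q j)) -> F = F'.
Proof.
move=> FF; apply: equifun_eq => n g; apply: eq_of_dist_le => e e0.
have e20 : 0 < e / 2 by rewrite divr_gt0.
have [A [oA Ag AF]] := equifun_continuous F n g e20.
have [A' [oA' Ag' AF']] := equifun_continuous F' n g e20.
have [j [Aj Aj']] := dense_meets (openI oA oA') (conj Ag Ag').
apply: le_trans (ler_distD (F n (q j)) _ _) _; rewrite [e]splitr.
by apply: lerD; [rewrite distrC; exact: AF|rewrite FF; exact: AF'].
Qed.

Lemma equicontinuous_translate F (g : G) :
  equicontinuous_for U (fun n h => F n (h * g)%g).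
Proof.
move=> n m h h' Uh; apply: (equifun_equicontinuous F).
by rewrite invgM mulgA -(mulgA h') mulgV mulg1.
Qed.

Definition equifun_translate (g : G) F : equifun R U :=
  EquiFun (equicontinuous_translate F g).

Definition equifun_coord (k : nat) F : R :=
  let p := odflt (0%N, 0%N) (unpickle k) in F p.1 (q p.2).

Lemma equifun_coord_pickle n j F : equifun_coord (pickle (n, j)) F = F n (q j).
Proof. by rewrite /equifun_coord pickleK. Qed.

Definition equifun_gen : set_system (equifun R U) :=
  \bigcup_k preimage_set_system setT (equifun_coord k) measurable.

Definition equifun_space := g_sigma_algebraType equifun_gen.

(** The moduli on the dense sequence are closed conditions on countably many coordinates, so a
    coordinatewise limit satisfies them and extends to an element of the space. *)
Lemma equifun_standard_borel : standard_borel R equifun_space.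
Proof.
apply: (@coord_standard_borel _ _ equifun_space equifun_coord) => //.
- move=> F F' FF; apply: equifun_dense_eq => n j.
  by rewrite -!equifun_coord_pickle.
- move=> u v uv.
  (* An index that codes no pair is read as (0, 0), so several indices can denote one coordinate;
     the limits must agree on them. *)
  have vE k : v k = v (pickle (odflt (0%N, 0%N) (unpickle k))).
    set k' := pickle _.
    apply: eq_of_dist_le => e e0; have e20 : 0 < e / 2 by rewrite divr_gt0.
    have [N NP] := uv k _ e20; have [N' NP'] := uv k' _ e20.
    pose i := maxn N N'.
    apply: le_trans (ler_distD (equifun_coord k (u i)) _ _) _; rewrite [e]splitr.
    apply: lerD; first by rewrite distrC; apply: NP; rewrite leq_maxl.
    have -> : equifun_coord k (u i) = equifun_coord k' (u i).
      by rewrite /equifun_coord /k' pickleK.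
    by apply: NP'; rewrite leq_maxr.
  have [|F FP] := @equicontinuous_extension (fun n j => v (pickle (n, j))).
    move=> n m j j' Uj; apply/ler_addgt0Pl => e e0.
    have e20 : 0 < e / 2 by rewrite divr_gt0.
    have [N NP] := uv (pickle (n, j)) _ e20.
    have [N' NP'] := uv (pickle (n, j')) _ e20.
    pose i := maxn N N'.
    have h1 := NP i (leq_maxl _ _); have h2 := NP' i (leq_maxr _ _).
    rewrite !equifun_coord_pickle in h1 h2.
    have h3 := equifun_equicontinuous (u i) Uj.
    apply: le_trans (ler_distD (u i n (q j')) _ _) _.
    apply: le_trans (lerD (lexx _) (ler_distD (u i n (q j)) _ _)) _.
    rewrite addrCA addrA -addrA [leRHS]addrC; apply: lerD => //.
    by rewrite [leRHS]splitr; apply: lerD => //; rewrite distrC.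
  exists F => k; rewrite vE /equifun_coord.
  by case: (odflt _ _) => n j; exact: FP.
Qed.

Lemma measurable_equifun d (X : measurableType d) (phi : X -> equifun_space) :
  (forall n j, measurable_fun setT (fun x => phi x n (q j))) ->
  measurable_fun setT phi.
Proof.
move=> mphi; apply: (@measurability _ _ _ equifun_space setT phi equifun_gen) => //.
move=> _ [_ [k _ [B mB <-]] <-].
rewrite !setTI -[X in measurable X]setTI; exact: mphi.
Qed.

Lemma measurable_equifun_coord n j :
  measurable_fun setT (fun F : equifun_space => F n (q j)).
Proof.
move=> _ B mB; apply: sub_sigma_algebra; exists (pickle (n, j)) => //.
by exists B => //; apply/seteqP; split=> F; rewrite /preimage /= equifun_coord_pickle.
Qed.

(** Taking the least admissible index makes the choice a Borel function of g. *)
Definition dense_approx (i : nat) (g : G) : nat := ex_minn (dense_approx_ex g i).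

Lemma dense_approx_cvg (F : equifun R U) n (g h : G) :
  F n (h * q (dense_approx i g))%g @[i --> \oo] --> F n (h * g)%g.
Proof.
apply/cvgrPdist_le => e e0.
have [A [oA Ag AF]] := equifun_continuous F n (h * g)%g e0.
have := open_mulgl h oA; rewrite oE => /(_ g Ag)[r r0 rA].
have [N Nr] := invn_lt r0; exists N => // i /= Ni.
rewrite distrC; apply: AF; apply: rA.
rewrite /dense_approx; case: ex_minnP => j gj _.
apply: lt_trans gj _; apply: le_lt_trans Nr.
by rewrite lef_pV2 ?posrE// ler_nat.
Qed.

Lemma measurable_equifun_eval n (g : G) :
  measurable_fun setT (fun F : equifun_space => F n g).
Proof.
apply: (measurable_fun_cvg (h := fun i (F : equifun_space) => F n (q (dense_approx i g)))).
  by move=> i; exact: measurable_equifun_coord.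
move=> F _; have := @dense_approx_cvg F n g 1%g; rewrite mul1g.
by under eq_fun do rewrite mul1g.
Qed.

Lemma measurable_dense_approx i c :
  measurable ([set g | dense_approx i g = c] : set (borel_group G)).
Proof.
have mB j : measurable ([set g | rho g (q j) < i.+1%:R^-1] : set (borel_group G)).
  apply: sub_sigma_algebra; rewrite (_ : [set _ | _] = [set g | rho (q j) g < i.+1%:R^-1]).
    by rewrite /= oE; exact: (metric_open_ball H).
  by apply/seteqP; split=> g /=; rewrite (pm_sym H).
rewrite (_ : [set _ | _] = [set g | rho g (q c) < i.+1%:R^-1] `\`
    \bigcup_j (if (j < c)%N then [set g | rho g (q j) < i.+1%:R^-1] else set0)).
  apply: measurableD => //; apply: bigcupT_measurable => j.
  by case: ifP => // _; exact: mB.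
apply/seteqP; split=> g /=.
  move=> <-; rewrite /dense_approx; case: ex_minnP => j gj jmin; split=> //.
  move=> [k _]; case: ifP => // kj gk.
  by have := jmin k gk; rewrite leqNgt kj.
move=> [gc nlt]; rewrite /dense_approx; case: ex_minnP => j gj jmin.
apply/eqP; rewrite eqn_leq jmin//= leqNgt; apply/negP => jc.
by apply: nlt; exists j => //; rewrite jc.
Qed.

(** Evaluation is measurable in F and continuous in g, hence jointly measurable: it is the limit of
    functions in which g is replaced by [q c] on the countably many Borel pieces given by
    [dense_approx]. *)
Lemma borel_action_translate :
  borel_action (equifun_translate : G -> equifun_space -> equifun_space).
Proof.
apply: measurable_equifun => n j /=.
apply: (measurable_fun_cvg (h := fun i (gF : borel_group G * equifun_space) =>
    gF.2 n (q j * q (dense_approx i gF.1))%g)); last first.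
  by move=> gF _; exact: dense_approx_cvg.
move=> i _ B mB; rewrite setTI.
rewrite (_ : _ @^-1` _ = \bigcup_c ([set g : borel_group G | dense_approx i g = c] `*`
    [set F : equifun_space | B (F n (q j * q c)%g)])).
  apply: bigcupT_measurable => c; apply: measurableX.
    exact: measurable_dense_approx.
  by rewrite -[X in measurable X]setTI; exact: measurable_equifun_eval.
apply/seteqP; split=> -[g F] /=; first by exists (dense_approx i g).
by move=> [c _ [/= <-]].
Qed.

End equifun_space.

(** * Measure preserving maps and inverses mod 0 *)

Lemma ae_measure_preserving (R : realType) d d' (X : measurableType d)
    (Y : measurableType d') (mu : probability X R) (nu : probability Y R)
    (T : X -> Y) (P : Y -> Prop) :
  measure_preserving mu nu T -> (\forall y \ae nu, P y) ->
  \forall x \ae mu, P (T x).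
Proof.
move=> [mT Tnu] [N [mN N0 PN]]; exists (T @^-1` N); split.
- by rewrite -[X in measurable X]setTI; exact: mT.
- by have := Tnu N mN; rewrite /pushforward N0.
- by move=> x nP; exact: PN.
Qed.

(** [B p] plays in Y the role of the p-th basic ball, and [psi y] is the only point close to all
    balls whose [B p] contains y. It exists when y belongs to such sets at every scale ([Y1]) and
    the corresponding centres are mutually compatible ([Y2]), by completeness; elsewhere [psi] takes
    a default value. For almost every x, the point x itself is close to all balls selected by
    [phi x]. *)
Lemma left_inverse_mod0 (R : realType) d d' (X : measurableType d)
    (Y : measurableType d') (mu : probability X R) (phi : X -> Y) :
  standard_borel R X -> measurable_fun setT phi ->
  (forall A, measurable A -> exists B, measurable B /\
    \forall x \ae mu, A x <-> B (phi x)) ->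
  exists psi : Y -> X, measurable_fun setT psi /\
    \forall x \ae mu, psi (phi x) = x.
Proof.
move=> /standard_borel_metric[rho [q [H mX]]] mphi phiB.
have mA (p : nat * nat) : measurable [set x | rho (q p.1) x < p.2.+1%:R^-1].
  by rewrite mX; apply: sub_sigma_algebra; exact: (metric_open_ball H).
have [B BP] := choice (fun p => phiB _ (mA p)).
have mB p : measurable (B p) by have [] := BP p.
pose close y x := forall p, B p y -> rho (q p.1) x <= p.2.+1%:R^-1.
pose Y1 := [set y | forall k, exists i, B (i, k) y].
pose Y2 := [set y | forall p p', B p y -> B p' y ->
  rho (q p.1) (q p'.1) <= p.2.+1%:R^-1 + p'.2.+1%:R^-1].
have close_ex y : Y1 y -> Y2 y -> exists x, close y x.
  move=> Y1y Y2y; have [i iP] := choice Y1y.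
  have [x xP] : exists x, forall n, rho (q (i n)) x <= n.+1%:R^-1.
    apply: (pm_complete H (u := fun n => q (i n))) => m n.
    exact: (Y2y (i m, m) (i n, n)).
  exists x => p Bp; apply/ler_addgt0Pl => e e0.
  have [k ke] := invn_lt (divr_gt0 e0 (ltr0n _ 2)).
  apply: le_trans (pm_tri H (q (i k)) _ _) _.
  apply: le_trans (lerD (Y2y p (i k, k) Bp (iP k)) (xP k)) _.
  by rewrite -addrA addrC lerD2r /= [leRHS]splitr lerD// ltW.
have close_uniq y x x' : Y1 y -> close y x -> close y x' -> x = x'.
  move=> Y1y yx yx'; apply: (pm_eq0 H); apply/eqP; rewrite eq_le; apply/andP; split.
    apply/ler_addgt0Pl => e e0; rewrite addr0.
    have [k ke] := invn_lt (divr_gt0 e0 (ltr0n _ 2)); have [i Bi] := Y1y k.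
    apply: le_trans (pm_tri H (q i) _ _) _; rewrite [e]splitr.
    apply: lerD; apply: le_trans (ltW ke); last exact: (yx' (i, k)).
    by rewrite (pm_sym H); exact: (yx (i, k)).
  have := pm_tri H x' x x; rewrite (pm_refl H) (pm_sym H x' x).
  by rewrite -mulr2n pmulrn_lge0.
have psiE y : exists x, (Y1 y /\ Y2 y -> close y x) /\ (~ (Y1 y /\ Y2 y) -> x = point).
  have [[Y1y Y2y]|nY] := pselect (Y1 y /\ Y2 y); last by exists point.
  by have [x yx] := close_ex y Y1y Y2y; exists x; split=> // nY; case: nY.
have [psi psiP] := choice psiE.
have mY1 : measurable Y1.
  rewrite (_ : Y1 = \bigcap_k \bigcup_i B (i, k)).
    by apply: bigcapT_measurable => k; exact: bigcupT_measurable.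
  apply/seteqP; split=> y Yy k.
    by move=> _; have [i Bi] := Yy k; exists i.
  by have [i _ Bi] := Yy k I; exists i.
have mY2 : measurable Y2.
  rewrite (_ : Y2 = \bigcap_i \bigcap_k \bigcap_j \bigcap_l
     (if rho (q i) (q j) <= k.+1%:R^-1 + l.+1%:R^-1 then setT
      else ~` (B (i, k) `&` B (j, l)))).
    do 4 (apply: bigcapT_measurable => ?).
    by case: ifP => // _; apply: measurableC; exact: measurableI.
  apply/seteqP; split=> y Yy.
    move=> i _ k _ j _ l _; case: ifPn => // /negP nle [Bi Bj]; apply: nle.
    exact: (Yy (i, k) (j, l)).
  move=> [i k] [j l] Bi Bj /=; have := Yy i I k I j I l I.
  by case: ifPn => // _ nB; case: nB.
exists psi; split.
  apply: (measurability _ mX) => _ [A oA <-]; rewrite setTI.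
  rewrite (_ : psi @^-1` A = ((Y1 `&` Y2) `&` \bigcup_i \bigcup_k
     (if `[< [set x | rho (q i) x <= k.+1%:R^-1] `<=` A >] then B (i, k) else set0))
     `|` (if `[< A point >] then ~` (Y1 `&` Y2) else set0)).
    apply: measurableU; last first.
      by case: ifP => // _; apply: measurableC; exact: measurableI.
    apply: measurableI; first exact: measurableI.
    apply: bigcupT_measurable => i; apply: bigcupT_measurable => k.
    by case: ifP.
  apply/seteqP; split=> y.
    move=> Ay; have [psic psip] := psiP y.
    have [Yy|nY] := pselect (Y1 y /\ Y2 y); last first.
      by right; rewrite asboolT//; rewrite -(psip nY).
    left; split=> //; have yx := psic Yy; have [e e0 eA] := oA _ Ay.
    have [k ke] := invn_lt (divr_gt0 e0 (ltr0n _ 2)); have [i Bi] := Yy.1 k.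
    exists i => //; exists k => //; rewrite asboolT// => z /= iz; apply: eA.
    apply: le_lt_trans (pm_tri H (q i) _ _) _; rewrite [e]splitr.
    apply: ltrD; apply: le_lt_trans ke => //.
    by rewrite (pm_sym H); exact: (yx (i, k)).
  move=> [[Yy [i _ [k _]]]|].
    case: asboolP => // iA Bi; apply: iA.
    by have [/(_ Yy) yx _] := psiP y; exact: (yx (i, k)).
  by case: asboolP => // Ap nY; have [_ /(_ nY)] := psiP y; rewrite /preimage /= => ->.
have : \forall x \ae mu, forall n, if unpickle n is Some p
    then rho (q p.1) x < p.2.+1%:R^-1 <-> B p (phi x) else True.
  apply: ae_foralln => n; case: unpickle => [p|]; last exact: aeW.
  by have [_] := BP p.
apply: filterS => x AB0.
have AB p : rho (q p.1) x < p.2.+1%:R^-1 <-> B p (phi x).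
  by have := AB0 (pickle p); rewrite pickleK.
have xx : close (phi x) x by move=> p /AB/ltW.
have Y1x : Y1 (phi x).
  move=> k; have [|i xi] := pm_dense H x (e := k.+1%:R^-1); first by rewrite invr_gt0.
  by exists i; apply/AB; rewrite /= (pm_sym H).
have Y2x : Y2 (phi x).
  move=> p p' /AB px /AB px'; apply: le_trans (pm_tri H x _ _) _.
  by apply: lerD; apply: ltW => //; rewrite (pm_sym H).
by have [/(_ (conj Y1x Y2x)) yx _] := psiP (phi x); exact: close_uniq yx xx.
Qed.

(** Off one null set every [f n] is [h n] composed with [phi], so there every set of the
    sigma-algebra generated by [f] is a preimage under [phi]. *)
Lemma generated_by_factor (R : realType) d d' (X : measurableType d)
    (Y : measurableType d') (mu : probability X R) (phi : X -> Y)
    (f : nat -> X -> R) (h : nat -> Y -> R) :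
  (forall n, measurable_fun setT (h n)) ->
  (forall n, \forall x \ae mu, h n (phi x) = f n x) ->
  (forall n, measurable_fun setT (f n)) -> generates_mod0 mu f ->
  forall A, measurable A -> exists B, measurable B /\
    \forall x \ae mu, A x <-> B (phi x).
Proof.
move=> mh /ae_foralln[N [mN N0 hfN]] mf gf A mA.
have hf n x : ~ N x -> h n (phi x) = f n x.
  by move=> Nx; apply: contrapT => ne; apply: Nx; apply: hfN => /(_ n).
have [S sS AS] := gf A mA.
have [B [mB BP]] : exists B, measurable B /\ forall x, ~ N x -> S x <-> B (phi x).
  move: S sS {AS}; apply: smallest_sub; last first.
    move=> _ [n _ [C mC <-]]; exists (h n @^-1` C); split.
      by rewrite -[X in measurable X]setTI; exact: mh.
    by move=> x Nx; rewrite setTI /preimage /= hf.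
  split.
  - by exists set0.
  - move=> S [B [mB BP]]; exists (~` B); split; first exact: measurableC.
    by move=> x /BP Sx; rewrite /setD /setC /= Sx; split=> // -[].
  - move=> S SP; have [B BP] := choice SP; exists (\bigcup_n B n); split.
      by apply: bigcupT_measurable => n; have [] := BP n.
    by move=> x Nx; split=> -[n _ ?]; exists n => //; have [_ /(_ x Nx) e] := BP n; exact/e.
have mS : measurable S.
  move: S sS {AS BP}; apply: smallest_sub; first exact: sigma_algebra_measurable.
  by move=> _ [n _ [C mC <-]]; exact: mf.
exists B; split=> //; exists (N `|` (A `+` S)); split.
- apply: measurableU => //; by rewrite /setY; apply: measurableU; exact: measurableD.
- have mAS : measurable (A `+` S) by rewrite /setY; apply: measurableU; exact: measurableD.
  apply/eqP; rewrite eq_le measure_ge0 andbT.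
  have s0 : (mu N + mu (A `+` S) <= 0)%E by rewrite N0 AS adde0.
  by apply: le_trans s0; exact: measureU2.
- move=> x nAB; have [Nx|Nx] := pselect (N x); [by left|right].
  apply: contrapT => nAS; apply: nAB; apply: iff_trans (BP x Nx).
  by split=> h'; apply: contrapT => nh; apply: nAS; [left|right].
Qed.

(** * Construction of the spatial model *)

Lemma G_continuous_spatial_model (R : realType) (G : topologicalGroupType)
    d (X : measurableType d) (mu : probability X R) (a : G -> X -> X)
    (f : nat -> X -> R) :
  polish R G -> standard_borel R X -> near_action mu a ->
  (forall n, G_continuous mu a (f n)) -> generates_mod0 mu f ->
  has_spatial_model mu a.
Proof.
move=> pG sX [ba a1 aM ap] fG fgen.
have mf n : measurable_fun setT (f n) by exact: G_continuous_measurable (fG n).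
have [rho [q [H oE]]] := polish_polish_metric (1%g : G) pG.
have Uex (nm : nat * nat) : exists U, [/\ open U, U 1%g & forall g, U g ->
    \forall x \ae mu, `|f nm.1 (a g x) - f nm.1 x| <= nm.2.+1%:R^-1].
  by apply: G_continuous_uniform => //; rewrite invr_gt0.
have [U0 U0P] := choice Uex.
pose U n m := U0 (n, m).
have oU n m : open (U n m) by have [] := U0P (n, m).
have U1 n m : U n m 1%g by have [] := U0P (n, m).
have mfa n g : measurable_fun setT (fun x => f n (a g x)).
  by apply: measurableT_comp => //; have [] := ap g.
(* The bound for g' * g^-1 is read at the point [a g x], which is legitimate almost everywhere
   because g preserves [mu]; then g' * g^-1 applied to g x is g' x mod 0. *)
have close n m g g' : U n m (g' * g^-1)%g ->
    \forall x \ae mu, `|f n (a g' x) - f n (a g x)| <= m.+1%:R^-1.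
  move=> Ug; have [_ _ /(_ _ Ug)/(ae_measure_preserving (ap g))] := U0P (n, m).
  move=> h; apply: filterS2 h (aM (g' * g^-1)%g g) => x /= + e.
  by rewrite e -mulgA mulVg mulg1.
pose Good := [set x | forall n m j j', U n m (q j' * (q j)^-1)%g ->
  `|f n (a (q j') x) - f n (a (q j) x)| <= m.+1%:R^-1].
have mGood : measurable Good.
  rewrite (_ : Good = \bigcap_n \bigcap_m \bigcap_j \bigcap_j'
    (if `[< U n m (q j' * (q j)^-1)%g >] then
      [set x | `|f n (a (q j') x) - f n (a (q j) x)| <= m.+1%:R^-1] else setT)).
    apply: bigcapT_measurable => n; apply: bigcapT_measurable => m.
    apply: bigcapT_measurable => j; apply: bigcapT_measurable => j'.
    case: ifP => // _; rewrite (_ : [set _ | _] =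
        (fun x => `|f n (a (q j') x) - f n (a (q j) x)|) @^-1` [set` `]-oo, m.+1%:R^-1]]).
      rewrite -[X in measurable X]setTI.
      have mg : measurable_fun setT (fun x => `|f n (a (q j') x) - f n (a (q j) x)|).
        by apply: measurableT_comp => //; apply: measurable_funB.
      exact: mg.
    by apply/seteqP; split=> x /=; rewrite in_itv.
  apply/seteqP; split=> x Gx.
    by move=> n _ m _ j _ j' _; case: asboolP => // Uj; exact: Gx.
  move=> n m j j' Uj; have := Gx n I m I j I j' I; by rewrite asboolT.
have aeGood : \forall x \ae mu, Good x.
  apply: ae_foralln => n; apply: ae_foralln => m; apply: ae_foralln => j.
  apply: ae_foralln => j'; have [Uj|nUj] := pselect (U n m (q j' * (q j)^-1)%g).
    by apply: filterS (close n m _ _ Uj) => x.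
  exact: aeW.
pose Y := @equifun_space R G q U.
(* Off [Good] the zero function is used, which has every modulus; the indicator keeps the
   coordinates of [phi] measurable. *)
have phiE x : exists F : Y, forall n j, F n (q j) = f n (a (q j) x) * \1_Good x.
  have [Gx|nGx] := pselect (Good x); last first.
    exists point => n j; by rewrite indicE memNset// mulr0.
  have [F FP] := equicontinuous_extension H oE oU U1 (w := fun n j => f n (a (q j) x)) Gx.
  by exists F => n j; rewrite FP indicE mem_set// mulr1.
have [phi phiP] := choice phiE.
have mphi : measurable_fun setT phi.
  apply: measurable_equifun => n j; under eq_fun do rewrite phiP.
  by apply: measurable_funM => //; exact: measurable_indic.
(* For g outside the dense sequence [phi x n g] is defined by continuity and not by the orbit of x;
   the two values agree off a null set that depends on g. *)
have phi_eval n g : \forall x \ae mu, phi x n g = f n (a g x).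
  have aeC : \forall x \ae mu, forall m j, U n m (q j * g^-1)%g ->
      `|f n (a (q j) x) - f n (a g x)| <= m.+1%:R^-1.
    apply: ae_foralln => m; apply: ae_foralln => j.
    have [Uj|nUj] := pselect (U n m (q j * g^-1)%g); last exact: aeW.
    by apply: filterS (close n m _ _ Uj) => x.
  apply: filterS2 aeGood aeC => x Gx Cx; apply: eq_of_dist_le => e e0.
  have [m me] := invn_lt (divr_gt0 e0 (ltr0n _ 2)).
  have [j Uj] : exists j, [set h | U n m (h * g^-1)%g] (q j).
    apply: (dense_meets H oE (g := g)); last by rewrite /= mulgV.
    exact: open_mulgr.
  have phij : phi x n (q j) = f n (a (q j) x).
    by rewrite phiP indicE mem_set// mulr1.
  apply: le_trans (ler_distD (phi x n (q j)) _ _) _; rewrite [e]splitr.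
  apply: lerD; apply: le_trans (ltW me).
    by rewrite distrC; exact: (equifun_equicontinuous (phi x)).
  by rewrite phij; exact: Cx.
pose b : G -> Y -> Y := @equifun_translate R G U.
have mb : borel_action b by exact: (borel_action_translate H oE oU U1).
have phib g : \forall x \ae mu, phi (a g x) = b g (phi x).
  have : \forall x \ae mu, forall n j, phi (a g x) n (q j) = b g (phi x) n (q j).
    apply: ae_foralln => n; apply: ae_foralln => j.
    have e1 := ae_measure_preserving (ap g) (phi_eval n (q j)).
    apply: filterS3 e1 (aM (q j) g) (phi_eval n (q j * g)%g) => x /= -> -> e3.
    by rewrite -e3.
  by apply: filterS => x; exact: (equifun_dense_eq H oE oU U1).
have mphi' : phi \in @mfun _ _ X Y by rewrite inE.
pose nu : probability Y R := distribution mu (mfun_Sub mphi').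
have nuE A : nu A = mu (phi @^-1` A) by [].
have mbg g : measurable_fun setT (b g).
  apply: measurable_equifun => n j.
  exact: (measurable_equifun_eval H oE oU U1 n (q j * g)%g).
have phi_mp : measure_preserving mu nu phi by split.
have [psi [mpsi psiphi]] : exists psi : Y -> X, measurable_fun setT psi /\
    \forall x \ae mu, psi (phi x) = x.
  apply: left_inverse_mod0 => //.
  (* Evaluation at the identity recovers [f n] from [phi], so the hypothesis that [f] generates says
     that [phi] loses nothing mod 0. *)
  apply: (generated_by_factor (f := f) (h := fun n (F : Y) => F n 1%g)) => //.
    by move=> n; exact: (measurable_equifun_eval H oE oU U1).
  by move=> n; apply: filterS2 a1 (phi_eval n 1%g) => x -> ->.
have eq_mu A B : measurable A -> measurable B ->
    (\forall x \ae mu, A x <-> B x) -> mu A = mu B.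
  move=> mA mB [N [mN N0 AN]].
  have le A1 A2 : measurable A1 -> measurable A2 ->
      (forall x, ~ N x -> A1 x -> A2 x) -> (mu A1 <= mu A2)%E.
    move=> mA1 mA2 A12; apply: (@le_trans _ _ (mu (A2 `|` N))).
      apply: le_measure; rewrite ?inE//; first exact: measurableU.
      by move=> x A1x; have [Nx|Nx] := pselect (N x); [right|left; exact: A12].
    have s0 : (mu A2 + mu N <= mu A2)%E by rewrite N0 adde0.
    by apply: le_trans s0; exact: measureU2.
  have ABN x : ~ N x -> A x <-> B x by move=> Nx; apply: contrapT => ne; apply: Nx; exact: AN.
  apply/eqP; rewrite eq_le; apply/andP; split; apply: le => // x Nx;
    by have [] := ABN x Nx.
exists _, Y, nu, b; split.
- exact: (equifun_standard_borel H oE oU U1).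
- split=> //.
  + move=> F; apply: equifun_eq => n g; by rewrite /= mulg1.
  + by move=> g h F; apply: equifun_eq => n k; rewrite /= mulgA.
  + move=> g; split=> // A mA; rewrite /pushforward !nuE.
    have [mag agmu] := ap g.
    have mphiA : measurable (phi @^-1` A) by rewrite -[X in measurable X]setTI; exact: mphi.
    rewrite -(agmu _ mphiA); apply: eq_mu.
    * rewrite -[X in measurable X]setTI; apply: mphi => //.
      by rewrite -[X in measurable X]setTI; exact: mbg.
    * by rewrite -[X in measurable X]setTI; exact: mag.
    * by apply: filterS (phib g) => x /= e; rewrite /preimage /= e.
- exists phi; split=> //; exists psi; split=> //.
  + split=> // A mA; rewrite /pushforward nuE; apply: eq_mu => //.
      rewrite -[X in measurable X]setTI; apply: mphi => //.
      by rewrite -[X in measurable X]setTI; exact: mpsi.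
    by apply: filterS psiphi => x; rewrite /preimage /= => ->.
  (* [D] is measurable since two elements of Y are compared on countably many coordinates. It is
     null for [nu] because its preimage under [phi] lies in the null set off which [psi] inverts
     [phi] on the left. *)
  + pose D := [set y | phi (psi y) <> y].
    have mD : measurable D.
      rewrite (_ : D = \bigcup_n \bigcup_j [set y : Y | phi (psi y) n (q j) <> y n (q j)]).
        apply: bigcupT_measurable => n; apply: bigcupT_measurable => j.
        rewrite (_ : [set _ | _] =
            (fun y : Y => phi (psi y) n (q j) - y n (q j)) @^-1` [set~ 0]).
          rewrite -[X in measurable X]setTI.
          have mg : measurable_fun setT (fun y : Y => phi (psi y) n (q j) - y n (q j)).
            apply: measurable_funB; last exact: measurable_equifun_coord.
            apply: (@measurableT_comp _ _ _ _ _ _ (fun F : Y => F n (q j))).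
              exact: measurable_equifun_coord.
            exact: measurableT_comp.
          apply: mg => //; apply: measurableC; exact: measurable_set1.
        apply/seteqP; split=> y /= ne.
          by move=> /eqP; rewrite subr_eq0 => /eqP.
        by move=> e; apply: ne; rewrite /= e subrr.
      apply/seteqP; split=> y.
        move=> Dy; apply: contrapT => nex; apply: Dy.
        apply: (equifun_dense_eq H oE oU U1) => n j; apply: contrapT => ne.
        by apply: nex; exists n => //; exists j.
      by move=> [n _ [j _ /= ne]] e; apply: ne; rewrite e.
    exists D; split=> //.
    rewrite nuE; have [N [mN N0 PN]] := psiphi.
    apply: (@subset_measure0 _ _ _ mu _ N) => //.
      by rewrite -[X in measurable X]setTI; exact: mphi.
    by move=> x Dx; apply: PN => e; apply: Dx; rewrite e.
Qed.

Theorem theorem2p2 (R : realType) (G : topologicalGroupType)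
    (d : measure_display) (X : measurableType d) (mu : probability X R)
    (a : G -> X -> X)
    (G_polish : polish R G) (X_standard : standard_borel R X)
    (a_near : near_action mu a) :
  (has_spatial_model mu a <->
     exists f : nat -> X -> R,
       (forall n, G_continuous mu a (f n)) /\ generates_mod0 mu f) /\
  (forall f : nat -> X -> R, (forall n, G_continuous mu a (f n)) ->
     (generates_mod0 mu f <-> separates_points_mod0 mu f)).
Proof.
have equiv (f : nat -> X -> R) : (forall n, G_continuous mu a (f n)) ->
    generates_mod0 mu f <-> separates_points_mod0 mu f.
  move=> fG; have mf n := G_continuous_measurable (fG n).
  by split; [exact: generates_separates|exact: separates_generates].
split=> //; split=> [model|[f [fG fgen]]].
  have [f [fG fsep]] := spatial_model_separating_functions G_polish model.
  by exists f; split=> //; exact/equiv.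
exact: G_continuous_spatial_model fG fgen.
Qed.
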